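(* Let $S$ be the second-order semi-Levy subordinator described in the context and suppose that all eigenvalues of the matrix $\mathbf A$ have negative real parts. Then the semi-Levy driven CARMA$(p,q)$ process $Y(t)=\mathbf b'\mathbf X(t)$ with parameters $a_1,\dots,a_p,b_0,\dots,b_q$, where $\mathbf X(t)=\int_{-\infty}^{t}e^{\mathbf A(t-u)}\mathbf e\,dS(u)$, is given by $$Y(t)=\int_{-\infty}^{\infty}h(t-u)\,dS(u),\qquad h(t)=\mathbf b'e^{\mathbf At}\mathbf e\,\mathbf 1_{[0,\infty)}(t).$$ Moreover, if $\mathbf X(t)$ is independent of $\{S(v)-S(t):v>t\}$ for all $t\in\mathbb R$, then $Y$ is a causal function of $S$.
   Context: Driving process: let $r\in\mathbb N$ and $0=s_0<s_1<s_2<\cdots$ be such that the intervals $B_i=(s_{i-1},s_i]$, $i\in\mathbb N$, partition $(0,\infty)$ and $|B_{i+kr}|=|B_i|$ for all $i,k\in\mathbb N$; let $\lambda_i>0$ with $\lambda_{i+kr}=\lambda_i$. Put $\ell_i=|B_i|$ and $T=\sum_{i=1}^r \ell_i$. Let $M$ be a Poisson random measure on $\mathbb R$ whose mean measure has the $T$-periodic density equal to $\lambda_i/\ell_i$ on $B_i$, and let its atoms carry i.i.d. real marks (jumps) distributed as a random variable $J$ with $E[J^2]<\infty$, independent of $M$. Let $\gamma\in\mathbb R$. The process $S=\{S(t),t\in\mathbb R\}$ satisfies $S(0)=0$ and, for $s<t$, $S(t)-S(s)=\gamma(t-s)+{}$(the sum of the jumps attached to the atoms of $M$ in $(s,t]$).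 $S$ is assumed to be a second-order subordinator (nondecreasing, with finite second moments). CARMA coefficients: $0\le q<p$ are integers; $a(z)=z^p+a_1z^{p-1}+\cdots+a_p$ and $b(z)=b_0+b_1z+\cdots+b_{p-1}z^{p-1}$ have real coefficients, $b_q=1$, $b_j=0$ for $q<j<p$, and $a(z)$, $b(z)$ have no common factors. $\mathbf A$ is the $p\times p$ companion matrix with ones on the superdiagonal, last row $(-a_p,-a_{p-1},\dots,-a_1)$ and zeros elsewhere; $\mathbf e=(0,\dots,0,1)'\in\mathbb R^p$; $\mathbf b=(b_0,\dots,b_{p-1})'$; $'$ denotes transpose. Integrals over $(-\infty,t]$ are $L^2$-limits as $s\to-\infty$ of the integrals over $(s,t]$, which are taken as $L^2$-limits of Riemann–Stieltjes sums (equivalently pathwise). The function $h$ is called the kernel of the CARMA process. ''$Y$ is a causal function of $S$'' means that for every $t$, $Y(t)$ is measurable with respect to the completed $\sigma$-algebra generated by the increments $S(v)-S(u)$, $u\le v\le t$. *)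

(* Defs.v *)
From HB Require Import structures.
From mathcomp Require Import all_boot all_order all_algebra.
From mathcomp Require Import all_classical all_reals all_analysis.
From mathcomp Require Import measurable_realfun.
From mathcomp.real_closed Require Import complex.

Set Implicit Arguments.
Unset Strict Implicit.
Unset Printing Implicit Defensive.

Import Order.TTheory GRing.Theory Num.Theory.
Import numFieldNormedType.Exports.

Local Open Scope classical_set_scope.
Local Open Scope ring_scope.

Section independence.
Context {d : measure_display} {T : measurableType d} {R : realType}.
Variable P : probability T R.

Definition mutually_independent (I : eqType) (F : I -> set (set T)) : Prop :=
  forall (r : seq I) (A : I -> set T), uniq r -> (forall i, F i (A i)) ->
    P (\bigcap_(i in [set` r]) A i) = (\prod_(i <- r) P (A i))%E.

Definition independent_systems (G H : set (set T)) : Prop :=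
  forall A B, G A -> H B -> P (A `&` B) = (P A * P B)%E.

Definition sigma_generated (I : Type) (D : set I) (X : I -> T -> R) :
    set (set T) :=
  <<s \bigcup_(i in D) preimage_set_system setT (X i) measurable >>.

(* All P-null sets of the ambient space are added, so that membership does not
   depend on the versions chosen. *)
Definition completed_sigma (G : set (set T)) : set (set T) :=
  <<s G `|` [set N | P.-negligible N] >>.

End independence.

Section driving_process.
Context {d : measure_display} {T : measurableType d} {R : realType}.
Variable P : probability T R.

(* Indices start at 0 here: [block s i] is B_(i+1), [block_length s i] is
   ell_(i+1), and [lam i] is lambda_(i+1). *)
Definition block (s : nat -> R) (i : nat) : set R := `]s i, s i.+1]%classic.

Definition block_length (s : nat -> R) (i : nat) : R := s i.+1 - s i.

Definition period (r : nat) (s : nat -> R) : R :=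
  \sum_(i < r) block_length s i.

Record periodic_blocks (r : nat) (s lam : nat -> R) : Prop := {
  pb_r_gt0 : (0 < r)%N ;
  pb_s0 : s 0 = 0 ;
  pb_s_incr : forall i, s i < s i.+1 ;
  pb_cover : \bigcup_i block s i = `]0, +oo[%classic ;
  pb_length : forall i k, block_length s (i + k * r) = block_length s i ;
  pb_lam_gt0 : forall i, 0 < lam i ;
  pb_lam : forall i k, lam (i + k * r) = lam i }.

(* These two conditions determine [rho] on the whole line. *)
Record periodic_intensity (r : nat) (s lam : nat -> R) (rho : R -> R) : Prop := {
  pi_periodic : forall x, rho (x + period r s) = rho x ;
  pi_block : forall i x, block s i x -> rho x = lam i / block_length s i }.

Definition mean_measure (rho : R -> R) (B : set (measurableTypeR R)) : \bar R :=
  (\int[lebesgue_measure]_(x in B) (rho x)%:E)%E.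

(* The [0%N] passed to [poisson_prob] is an argument that the library's
   definition ignores. [poisson_prob 0 _] is the Dirac mass at 0. *)
Record poisson_random_measure (mu : set (measurableTypeR R) -> \bar R)
    (M : R.-ker T ~> measurableTypeR R) : Prop := {
  prm_law : forall B : set (measurableTypeR R), measurable B ->
    (mu B < +oo)%E -> forall k : nat,
    P [set w | M w B = k%:R%:E] = poisson_prob (fine (mu B)) 0%N [set k] ;
  prm_indep : forall B : nat -> set (measurableTypeR R),
    (forall i, measurable (B i)) -> trivIset setT B ->
    mutually_independent P (fun i =>
      preimage_set_system setT (fun w => M w (B i)) measurable) }.

(* [atom n] is the location of the n-th atom of M, [mark n] the jump it
   carries. The order of the enumeration is immaterial, but the marks have to
   be independent of the enumeration and not just of the set of atoms. *)
Record iid_marked_atoms (M : R.-ker T ~> measurableTypeR R)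
    (J : {RV P >-> R}) (atom mark : nat -> {RV P >-> R}) : Prop := {
  ma_atoms : forall w (B : set (measurableTypeR R)), measurable B ->
    M w B = (\sum_(n <oo) \d_(atom n w : measurableTypeR R) B)%E ;
  ma_mark_law : forall n (B : set R), measurable B ->
    P (mark n @^-1` B) = P (J @^-1` B) ;
  ma_mark_indep : mutually_independent P (fun n =>
    preimage_set_system setT (mark n : T -> R) measurable) ;
  ma_mark_atom_indep : independent_systems P
    (sigma_generated setT (fun n => mark n : T -> R))
    (sigma_generated setT (fun n => atom n : T -> R)) }.

Definition compound_path (gamma : R) (atom mark : nat -> {RV P >-> R})
    (S : R -> {RV P >-> R}) : Prop :=
  {ae P, forall w, S 0 w = 0 /\
    forall s t, s < t ->
      S t w - S s w = gamma * (t - s)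
        + \sum_(n \in [set n | s < atom n w <= t]) mark n w}.

Record second_order_subordinator (S : R -> {RV P >-> R}) : Prop := {
  sub_nondecreasing : {ae P, forall w, forall s t, s <= t -> S s w <= S t w} ;
  sub_moment2 : forall t, (S t : T -> R) \in Lfun P 2%:E }.

Definition sigma_increments (S : R -> {RV P >-> R}) (D : set (R * R)) :
    set (set T) :=
  sigma_generated D (fun uv w => S uv.2 w - S uv.1 w).

Definition causal_function (S : R -> {RV P >-> R}) (Y : R -> T -> R) : Prop :=
  forall t (B : set R), measurable B ->
    completed_sigma P
      (sigma_increments S [set uv | uv.1 <= uv.2 /\ uv.2 <= t])
      (Y t @^-1` B).

End driving_process.

Section L2_integrals.
Context {d : measure_display} {T : measurableType d} {R : realType}.
Variable P : probability T R.
Variable S : R -> {RV P >-> R}.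

Definition L2_dist (X Y : T -> R) : \bar R := 'N[P]_2%:E[EFin \o (X \- Y)].

Record tagged_partition (s t mesh : R) (n : nat) (u xi : nat -> R) : Prop := {
  tp_first : u 0 = s ;
  tp_last : u n = t ;
  tp_incr : forall i, (i < n)%N -> u i < u i.+1 ;
  tp_tag : forall i, (i < n)%N -> u i <= xi i <= u i.+1 ;
  tp_mesh : forall i, (i < n)%N -> u i.+1 - u i < mesh }.

Definition RS_sum (f : R -> R) (n : nat) (u xi : nat -> R) (w : T) : R :=
  \sum_(i < n) f (xi i) * (S (u i.+1) w - S (u i) w).

(* The integrals are random variables defined up to a null set, hence relations:
   [I] is a version of the integral. *)
Definition is_RS_integral (f : R -> R) (s t : R) (I : T -> R) : Prop :=
  I \in Lfun P 2%:E /\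
  forall eps : R, 0 < eps -> exists2 delta : R, 0 < delta &
    forall n u xi, tagged_partition s t delta n u xi ->
      (L2_dist (RS_sum f n u xi) I < eps%:E)%E.

Definition is_RS_integral_ninfty (f : R -> R) (t : R) (I : T -> R) : Prop :=
  I \in Lfun P 2%:E /\
  exists2 G : R -> T -> R,
    (forall s, s < t -> is_RS_integral f s t (G s)) &
    L2_dist (G s) I @[s --> -oo] --> 0%E.

(* The two endpoints tend to -oo and +oo independently of each other. *)
Definition is_RS_integral_line (f : R -> R) (I : T -> R) : Prop :=
  I \in Lfun P 2%:E /\
  exists2 G : R -> R -> T -> R,
    (forall s v, s < v -> is_RS_integral f s v (G s v)) &
    L2_dist (G sv.1 sv.2) I @[sv --> (ninfty_nbhs R, pinfty_nbhs R)] --> 0%E.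

End L2_integrals.

Section carma.
Context {R : realType}.

Definition ar_poly (p : nat) (a : nat -> R) : {poly R} :=
  'X^p + \sum_(1 <= i < p.+1) a i *: 'X^(p - i).

Definition ma_poly (p : nat) (b : nat -> R) : {poly R} :=
  \sum_(j < p) b j *: 'X^j.

Record carma_coefficients (p q : nat) (a b : nat -> R) : Prop := {
  cc_lt : (q < p)%N ;
  cc_bq : b q = 1 ;
  cc_b0 : forall j, (q < j < p)%N -> b j = 0 ;
  cc_coprime : coprimep (ar_poly p a) (ma_poly p b) }.

(* Columns are numbered from 0, so the last row -a_p, ..., -a_1 has - a (p - j)
   in column j. *)
Definition carma_mx (p : nat) (a : nat -> R) : 'M[R]_p :=
  \matrix_(i < p, j < p)
    if i.+1 == p then - a (p - j)%N else ((j : nat) == i.+1)%:R.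

Definition carma_e (p : nat) : 'cV[R]_p := \col_(i < p) (i.+1 == p)%:R.

Definition carma_b (p : nat) (b : nat -> R) : 'cV[R]_p := \col_(j < p) b j.

Definition expmx (p : nat) (A : 'M[R]_p) : 'M[R]_p :=
  \matrix_(i, j) limn (series (fun k => (A ^+ k) i j / k`!%:R)).

Definition spectrum_negative (p : nat) (A : 'M[R]_p) : Prop :=
  forall z : R[i], eigenvalue (map_mx (real_complex R) A) z ->
    complex.Re z < 0.

Definition carma_kernel (p : nat) (a b : nat -> R) (t : R) : R :=
  ((carma_b p b)^T *m expmx (t *: carma_mx p a) *m carma_e p) ord0 ord0
    * \1_`[0, +oo[%classic t.

Context {d : measure_display} {T : measurableType d}.
Variable P : probability T R.

Definition is_carma_state (p : nat) (a : nat -> R) (S : R -> {RV P >-> R})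
    (X : R -> T -> 'cV[R]_p) : Prop :=
  forall t (i : 'I_p),
    is_RS_integral_ninfty S
      (fun u => (expmx ((t - u) *: carma_mx p a) *m carma_e p) i ord0)
      t (fun w => X t w i ord0).

Definition carma_process (p : nat) (b : nat -> R) (X : R -> T -> 'cV[R]_p)
    (t : R) (w : T) : R :=
  ((carma_b p b)^T *m X t w) ord0 ord0.

Definition independent_of_future (p : nat) (S : R -> {RV P >-> R})
    (X : R -> T -> 'cV[R]_p) : Prop :=
  forall t, independent_systems P
    (sigma_generated setT (fun (i : 'I_p) w => X t w i ord0))
    (sigma_increments S [set uv | uv.1 = t /\ t < uv.2]).

End carma.

(* Main.v *)
Require Import Defs.
From HB Require Import structures.
From mathcomp Require Import all_boot all_order all_algebra.
From mathcomp Require Import all_classical all_reals all_analysis.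
From mathcomp Require Import measurable_realfun.
From mathcomp Require Import ring lra.
From mathcomp.real_closed Require Import complex.

(** Two estimates carry the theorem, one on the kernel and one on the driver.

    The kernel of the state is made of entries of exp(xA). Such an entry solves
    the scalar linear equation whose characteristic polynomial is that of A;
    taking off the roots one by one, each of them with negative real part, shows
    that it decays exponentially ([egf_decay], [stable_mxpow_decay]).

    The L^2 norm of an increment S(v) - S(u) is bounded by a function of v - u
    alone, which tends to 0 with v - u ([increment_modulusP]). Indeed the
    intensity is bounded, being periodic; if N is the number of atoms in the
    window, the Cauchy-Schwarz inequality bounds the square of the sum of the
    jumps by N times the sum of their squares, and by independence of the marks
    and the atoms the expectation of this product is E[J^2] E[N^2], where N is a
    Poisson variable.

    The paths of S being nondecreasing, two Riemann-Stieltjes sums of a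
    continuous function over fine partitions differ by at most its oscillation
    times the increment of S ([path_sum_compare]). A jump of the integrand at t
    adds a constant multiple of the increment of S over a small window around t,
    which is small in L^2. So the sums are Cauchy and the completeness of L^2
    ([L2_complete]) gives the integrals over bounded intervals, also for the
    kernel u |-> h(t - u), which is cut off at t. Cutting a half-line into unit
    blocks and summing the geometric series of their contributions
    ([RS_integral_tail]) gives the integrals over (-oo, t], hence X.

    By linearity Y(t) is the integral over (-oo, t] of
    u |-> b' exp(A (t - u)) e. Partitions that have t as a node and right end
    points as tags do not see the cut-off kernel beyond t, so the integral over
    the line is the same variable ([line_of_ninfty]). Finally Y(t) is an
    L^2-limit of Riemann-Stieltjes sums over intervals that end at t, hence an
    almost sure limit along a subsequence, and these sums only use increments
    of S before t ([causal_of_ninfty]). *)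

Set Implicit Arguments.
Unset Strict Implicit.
Unset Printing Implicit Defensive.

Import Order.TTheory GRing.Theory Num.Theory.
Import numFieldNormedType.Exports.

Local Open Scope classical_set_scope.
Local Open Scope ring_scope.

(** * Square-integrable random variables *)

Section L2.
Context {d : measure_display} {T : measurableType d} {R : realType}.
Variable P : probability T R.
Implicit Types X Y Z : T -> R.

Definition L2norm X : \bar R := 'N[P]_2%:E[EFin \o X].

Lemma L2distE X Y : L2_dist P X Y = L2norm (X \- Y).
Proof. by []. Qed.

Lemma L2norm_ge0 X : (0 <= L2norm X)%E.
Proof. exact: Lnorm_ge0. Qed.

Lemma L2norm_sqr X : (L2norm X `^ 2 = \int[P]_w (X w ^+ 2)%:E)%E.
Proof.
rewrite poweR_Lnorm//; apply: eq_integral => w _ /=.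
by rewrite powR_mulrn// real_normK ?num_real.
Qed.

Lemma Lfun2_measurable X : X \in Lfun P 2%:E -> measurable_fun setT X.
Proof. by move=> /andP[/[!inE]/= ]. Qed.

Lemma Lfun2P X : measurable_fun setT X ->
  (X \in Lfun P 2%:E) = (L2norm X < +oo)%E.
Proof.
move=> mX; apply/idP/idP => [/andP[_]|h]; first by rewrite inE.
by apply/andP; split; rewrite inE.
Qed.

Lemma measurable_sqrE X : measurable_fun setT X ->
  measurable_fun setT (fun w => (X w ^+ 2)%:E).
Proof. by move=> mX; apply/measurable_EFinP; exact: measurable_funX. Qed.

Lemma L2norm_le_ae X Y : measurable_fun setT X -> measurable_fun setT Y ->
  {ae P, forall w, `|X w| <= `|Y w|} -> (L2norm X <= L2norm Y)%E.
Proof.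
move=> mX mY XY; rewrite /L2norm unlock; apply: gt0_ler_poweR.
- by rewrite invr_ge0.
- by rewrite in_itv/= leey andbT integral_ge0// => w _; exact: poweR_ge0.
- by rewrite in_itv/= leey andbT integral_ge0// => w _; exact: poweR_ge0.
have m Z : measurable_fun setT Z ->
    measurable_fun setT (fun w => (`|(EFin \o Z) w| `^ 2)%E).
  move=> mZ; apply: (measurableT_comp (measurable_poweR _)) => //.
  by apply: measurableT_comp => //; exact/measurable_EFinP.
apply: ae_ge0_le_integral => //.
- by move=> w _; exact: poweR_ge0.
- exact: (m _ mX).
- by move=> w _; exact: poweR_ge0.
- exact: (m _ mY).
apply: filterS XY => w h _.
by rewrite lee_fin ge0_ler_powR// ?nnegrE.
Qed.

Lemma L2norm_eq_ae X Y : measurable_fun setT X -> measurable_fun setT Y ->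
  {ae P, forall w, X w = Y w} -> L2norm X = L2norm Y.
Proof.
move=> mX mY XY; apply/eqP; rewrite eq_le; apply/andP; split;
  by apply: L2norm_le_ae => //; apply: filterS XY => w ->.
Qed.

Lemma L2norm_leP X c : 0 <= c ->
  (L2norm X <= c%:E)%E = (\int[P]_w (X w ^+ 2)%:E <= (c ^+ 2)%:E)%E.
Proof.
move=> c0; rewrite -L2norm_sqr; have := L2norm_ge0 X.
case: (L2norm X) => [x| |//]; last by move=> _; rewrite poweRyr// !leye_eq.
rewrite lee_fin => x0.
by rewrite poweR_EFin powR_mulrn// !lee_fin ler_sqr.
Qed.

Lemma L2norm_triangle X Y : measurable_fun setT X -> measurable_fun setT Y ->
  (L2norm (X \+ Y)%R <= L2norm X + L2norm Y)%E.
Proof. by move=> mX mY; apply: eminkowski => //; rewrite lee1n. Qed.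

Lemma L2normN X : L2norm (fun w => - X w) = L2norm X.
Proof. by rewrite -[RHS]oppe_Lnorm. Qed.

Lemma L2norm0 : L2norm (fun=> 0) = 0%E.
Proof. by rewrite -[RHS](@Lnorm0 _ _ _ P 2%:E). Qed.

Lemma L2normZ a X : measurable_fun setT X ->
  L2norm (fun w => a * X w) = (`|a|%:E * L2norm X)%E.
Proof.
move=> mX; rewrite /L2norm unlock.
have -> : (\int[P]_w (`|(EFin \o (fun w => (a * X w)%R)) w| `^ 2) =
    (`|a| `^ 2)%:E * \int[P]_w (`|(EFin \o X) w| `^ 2))%E.
  rewrite -ge0_integralZl//=.
  - by apply: eq_integral => w _; rewrite /= normrM powRM.
  - apply/measurable_EFinP; apply: (measurableT_comp (measurable_powR _)) => //.
    exact: measurableT_comp.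
have I0 : (0 <= \int[P]_w (`|(EFin \o X) w| `^ 2))%E.
  by apply: integral_ge0 => w _; exact: poweR_ge0.
rewrite poweRM// ?lee_fin ?powR_ge0//.
by congr (_ * _)%E; rewrite poweR_EFin -powRrM mulfV// powRr1.
Qed.

Lemma L2dist_sym X Y : L2_dist P X Y = L2_dist P Y X.
Proof.
rewrite !L2distE -L2normN; congr L2norm.
by apply/funext => w /=; rewrite opprB.
Qed.

Lemma L2dist_triangle X Y Z : measurable_fun setT X -> measurable_fun setT Y ->
  measurable_fun setT Z ->
  (L2_dist P X Z <= L2_dist P X Y + L2_dist P Y Z)%E.
Proof.
move=> mX mY mZ; rewrite !L2distE.
have -> : X \- Z = (X \- Y) \+ (Y \- Z).
  by apply/funext => w /=; rewrite addrA subrK.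
by apply: L2norm_triangle; exact: measurable_funB.
Qed.

Lemma L2dist_ge0 X Y : (0 <= L2_dist P X Y)%E.
Proof. exact: Lnorm_ge0. Qed.

Lemma ae_of_L2dist0 X Y : measurable_fun setT X -> measurable_fun setT Y ->
  (forall e : R, 0 < e -> (L2_dist P X Y <= e%:E)%E) -> {ae P, forall w, X w = Y w}.
Proof.
move=> mX mY h.
have h0 : L2_dist P X Y = 0%E.
  by apply/eqP; rewrite eq_le L2dist_ge0 andbT; apply/lee_addgt0Pr => e e0; rewrite add0e h.
have mXY : measurable_fun setT (EFin \o (X \- Y)).
  by apply/measurable_EFinP; exact: measurable_funB.
have p2 : (0 < 2%:E :> \bar R)%E by rewrite lte_fin.
have := Lnorm_eq0_eq0 mXY p2 h0.
by apply: filterS => w /= /(_ Logic.I) [] /eqP; rewrite subr_eq0 => /eqP.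
Qed.

End L2.

Lemma geometric_cauchy (R : realType) (u : nat -> R) (c : R) : 0 <= c ->
  (forall n, `|u n - u n.+1| <= 2^-1 ^+ n * c) ->
  exists2 l, u @ \oo --> l & forall n, `|u n - l| <= 2^-1 ^+ n * (2 * c).
Proof.
move=> c0 hu.
have step n k : `|u n - u (n + k)%N| <= 2^-1 ^+ n * (2 * c) - 2^-1 ^+ (n + k) * (2 * c).
  elim: k => [|k ih]; first by rewrite addn0 !subrr normr0.
  rewrite -(subrK (u (n + k)%N) (u n)) -addrA (le_trans (ler_normD _ _))//.
  rewrite addnS (le_trans (lerD ih (hu _)))// exprS.
  by rewrite le_eqVlt; apply/orP; left; apply/eqP; field.
have step' n m : (n <= m)%N -> `|u n - u m| <= 2^-1 ^+ n * (2 * c).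
  move=> nm; rewrite -(subnKC nm) (le_trans (step _ _))// lerBlDr lerDl.
  by rewrite mulr_ge0// ?exprn_ge0// ?mulr_ge0// invr_ge0.
have g0 : (fun n => 2^-1 ^+ n * (2 * c)) @ \oo --> (0 : R).
  rewrite -(mul0r (2 * c)); apply: cvgMl.
  by apply: cvg_expr; rewrite ger0_norm ?invr_ge0// invf_lt1// ltr1n.
have /cvg_ex[l ul] : cvgn u.
  apply/cauchy_cvgP/cauchy_exP => e e0.
  have [N _ hN] := (cvgr0Pnorm_lt _).1 g0 _ e0.
  exists (u N); exists N => // m /= Nm; rewrite /ball/=.
  rewrite (le_lt_trans (step' _ _ Nm))//.
  by have := hN _ (leqnn N); apply: le_lt_trans; rewrite ler_norm.
exists l => // n.
have h : (fun m => `|u n - u m|) @ \oo --> `|u n - l|.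
  by apply: cvg_norm; apply: cvgB => //; exact: cvg_cst.
by apply: (cvgr_to_le h); exists n => // m /= nm; exact: step'.
Qed.

Section L2_convergence.
Context {d : measure_display} {T : measurableType d} {R : realType}.
Variable P : probability T R.
Implicit Types X Y Z : T -> R.
Local Notation L2norm := (L2norm P).

(** The square of W is the sum of the 4^n X_n^2, whose expectation is bounded
    by a geometric series. One square-integrable W dominates all the X_n at a
    geometric rate, which yields almost sure and L^2 statements at once. *)
Lemma fast_L2_decay (X : nat -> T -> R) :
  (forall n, measurable_fun setT (X n)) ->
  (forall n, (L2norm (X n) <= (4^-1 ^+ n)%:E)%E) ->
  exists W : T -> R, [/\ W \in Lfun P 2%:E, forall w, 0 <= W w &
    {ae P, forall w, forall n, `|X n w| <= 2^-1 ^+ n * W w}].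
Proof.
move=> mX hX.
pose V w := (\sum_(n <oo) (4 ^+ n * X n w ^+ 2)%:E)%E.
have V0 w : (0 <= V w)%E.
  by apply: nneseries_ge0 => n _ _; rewrite lee_fin mulr_ge0 ?sqr_ge0.
have mterm n : measurable_fun setT (fun w => (4 ^+ n * X n w ^+ 2)%:E).
  by apply/measurable_EFinP; apply: measurable_funM => //; exact: measurable_funX.
have mV : measurable_fun setT V.
  by apply: ge0_emeasurable_sum => // n w _ _; rewrite lee_fin mulr_ge0 ?sqr_ge0.
have IV : (\int[P]_w V w <= 2%:E)%E.
  rewrite integral_nneseries//; last first.
    by move=> n w _; rewrite lee_fin mulr_ge0 ?sqr_ge0.
  have -> : 2%:E = (\sum_(n <oo) (2 / (2 ^ (n + 1))%:R : R)%:E)%E.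
    by have /cvg_lim := @cvg_geometric_eseries_half R 2 0; rewrite expr0 divr1 => ->.
  apply: lee_nneseries => [n _ _|n _].
    by apply: integral_ge0 => w _; rewrite lee_fin mulr_ge0 ?sqr_ge0.
  under eq_integral do rewrite EFinM.
  rewrite (ge0_integralZl P measurableT (measurable_sqrE (mX n)))//; last first.
    by move=> w _; rewrite lee_fin sqr_ge0.
  apply: (@le_trans _ _ ((4 ^+ n)%:E * ((4^-1 ^+ n) ^+ 2)%:E)%E).
    by rewrite lee_wpmul2l ?lee_fin// -L2norm_leP.
  rewrite -EFinM lee_fin expr2 mulrA -exprMn mulfV// expr1n mul1r.
  rewrite addn1 natrX exprS invfM mulrA mulfV// mul1r exprVn lef_pV2 ?posrE//.
  by rewrite lerXn2r ?nnegrE// ler_nat.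
have iV : P.-integrable setT V.
  apply/integrableP; split => //.
  by under eq_integral do rewrite gee0_abs//; exact: le_lt_trans IV (ltry _).
have aeV := integrable_ae measurableT iV.
pose W w := Num.sqrt (fine (V w)).
have fV0 w : 0 <= fine (V w) by exact: fine_ge0.
have mW : measurable_fun setT W.
  apply: measurableT_comp; last exact: measurableT_comp.
  by apply: continuous_measurable_fun; exact: sqrt_continuous.
exists W; split.
- rewrite Lfun2P// (@le_lt_trans _ _ (2%:E : \bar R)) ?ltry//.
  rewrite L2norm_leP// (le_trans _ (le_trans IV _))//; last first.
    by rewrite lee_fin -{1}(expr1 2) ler_eXn2l// ltr1n.
  apply: ge0_le_integral => //.
  + by move=> w _; rewrite lee_fin sqr_ge0.
  + exact: measurable_sqrE.
  + move=> w _; rewrite sqr_sqrtr//.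
    by have := V0 w; case: (V w) => // r; rewrite leey.
- by move=> w; exact: sqrtr_ge0.
apply: filterS aeV => w /(_ Logic.I) fV n.
have : ((4 ^+ n * X n w ^+ 2)%:E <= V w)%E.
  have h0 m : true -> (0 <= (4 ^+ m * X m w ^+ 2)%:E)%E.
    by rewrite lee_fin mulr_ge0 ?sqr_ge0.
  by rewrite /V (@nneseriesD1 _ _ n xpredT h0)//= leeDl// nneseries_ge0// => m _ _; exact: h0.
rewrite -(fineK fV) lee_fin => h.
rewrite -(ler_pXn2r (ltn0Sn 1)) ?nnegrE// ?mulr_ge0// ?exprn_ge0// ?invr_ge0// ?sqrtr_ge0//.
rewrite real_normK ?num_real// exprMn sqr_sqrtr// -exprM mulnC exprM exprVn.
rewrite (_ : 2 ^+ 2 = 4 :> R); last by rewrite -natrX.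
by rewrite exprVn ler_pdivlMl ?exprn_gt0.
Qed.

Lemma fast_L2_cvg_ae (X : nat -> T -> R) Y :
  (forall n, measurable_fun setT (X n)) -> measurable_fun setT Y ->
  (forall n, (L2_dist P (X n) Y <= (4^-1 ^+ n)%:E)%E) ->
  {ae P, forall w, X n w @[n --> \oo] --> Y w}.
Proof.
move=> mX mY hX.
have [|//|W [_ W0]] := @fast_L2_decay (fun n => X n \- Y).
  by move=> n; exact: measurable_funB.
apply: filterS => w h.
apply/cvgrPdistC_lt => e e0.
have g0 : (fun n => 2^-1 ^+ n * W w) @ \oo --> (0 : R).
  rewrite -(mul0r (W w)); apply: cvgMl.
  by apply: cvg_expr; rewrite ger0_norm ?invr_ge0// invf_lt1// ltr1n.
near=> n; rewrite (le_lt_trans (h n))//.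
rewrite (le_lt_trans (ler_norm _))//; near: n.
exact: cvgr0_norm_lt.
Unshelve. all: by end_near. Qed.

(** The limit is defined as a limit superior, which is measurable even where
    the sequence diverges. *)
Lemma fast_L2_cauchy_cvg (X : nat -> T -> R) :
  (forall n, X n \in Lfun P 2%:E) ->
  (forall n, (L2_dist P (X n) (X n.+1) <= (4^-1 ^+ n)%:E)%E) ->
  exists2 Y, Y \in Lfun P 2%:E & exists C : R, forall n,
    (L2_dist P (X n) Y <= (2^-1 ^+ n * C)%:E)%E.
Proof.
move=> LX hX.
have mX n := Lfun2_measurable (LX n).
have [|//|W [LW W0 aeW]] := @fast_L2_decay (fun n => X n \- X n.+1).
  by move=> n; exact: measurable_funB.
have mW := Lfun2_measurable LW.
pose Y w := fine (limn_esup (fun n => (X n w)%:E)).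
have mY : measurable_fun setT Y.
  apply: measurableT_comp => //; apply: measurable_fun_limn_esup => n.
  exact/measurable_EFinP.
have aeY n : {ae P, forall w, `|X n w - Y w| <= `|2^-1 ^+ n * 2 * W w|}.
  apply: filterS aeW => w h.
  have [l Xl hl] := geometric_cauchy (W0 w) h.
  rewrite [leRHS]ger0_norm ?mulr_ge0// ?exprn_ge0// ?invr_ge0// -mulrA.
  suff -> : Y w = l by exact: hl.
  have Xl' : (X n w)%:E @[n --> \oo] --> l%:E by apply: cvg_EFin => //; exact: nearW.
  rewrite /Y is_cvg_limn_esupE; last by apply/cvg_ex; exists l%:E.
  by rewrite (cvg_lim _ Xl').
have NW : (L2norm W < +oo)%E by rewrite -Lfun2P.
have dY n : (L2_dist P (X n) Y <= (2^-1 ^+ n * (2 * fine (L2norm W)))%:E)%E.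
  rewrite L2distE.
  rewrite (le_trans (L2norm_le_ae _ _ (aeY n)))//.
  - exact: measurable_funB.
  - exact: measurable_funM.
  rewrite L2normZ// ger0_norm ?mulr_ge0// ?exprn_ge0// ?invr_ge0//.
  rewrite mulrA [leRHS]EFinM fineK// ge0_fin_numE//; exact: L2norm_ge0.
exists Y; last by exists (2 * fine (L2norm W)).
rewrite Lfun2P//.
have -> : Y = (fun w => - (X 0%N \- Y) w) \+ X 0%N.
  by apply/funext => w /=; rewrite opprB subrK.
have mD : measurable_fun setT (fun w => - (X 0%N \- Y) w).
  by apply: measurable_funN; exact: measurable_funB.
rewrite (le_lt_trans (L2norm_triangle P mD (mX 0%N)))//.
rewrite lte_add_pinfty//; last by rewrite -Lfun2P.
by rewrite L2normN (le_lt_trans (dY 0%N))// ltry.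
Qed.

(** A subsequence is chosen along which consecutive distances are at most 4^-k. *)
Lemma L2_complete (X : nat -> T -> R) : (forall n, X n \in Lfun P 2%:E) ->
  (forall e : R, 0 < e -> exists N, forall m n, (N <= m)%N -> (N <= n)%N ->
     (L2_dist P (X m) (X n) <= e%:E)%E) ->
  exists2 Y, Y \in Lfun P 2%:E & forall e : R, 0 < e -> exists N, forall n,
    (N <= n)%N -> (L2_dist P (X n) Y <= e%:E)%E.
Proof.
move=> LX cX.
have cX' k : exists N, forall m n, (N <= m)%N -> (N <= n)%N ->
     (L2_dist P (X m) (X n) <= (4^-1 ^+ k)%:E)%E.
  by apply: cX; rewrite exprn_gt0// invr_gt0.
have [N hN] := choice cX'.
(* a monotone majorant of N *)
pose M k := \sum_(i < k.+1) N i.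
have NM k : (N k <= M k)%N by rewrite /M big_ord_recr/= leq_addl.
have NMS k : (N k <= M k.+1)%N.
  by rewrite /M big_ord_recr/= (leq_trans (NM k))// leq_addr.
have [|k|Y LY [C hY]] := @fast_L2_cauchy_cvg (X \o M).
- by move=> k; exact: LX.
- exact: hN.
exists Y => // e e0.
have mX n := Lfun2_measurable (LX n).
have mY := Lfun2_measurable LY.
have g0 : (fun n => 2^-1 ^+ n * C + 4^-1 ^+ n) @ \oo --> (0 : R).
  rewrite -[0](addr0) -{1}(mul0r C); apply: cvgD.
    apply: cvgMl.
  by apply: cvg_expr; rewrite ger0_norm ?invr_ge0// invf_lt1// ltr1n.
  by apply: cvg_expr; rewrite ger0_norm ?invr_ge0// invf_lt1// ltr1n.
have [k _ hk] := (cvgr0Pnorm_lt _).1 g0 _ e0.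
exists (N k) => n kn.
rewrite (le_trans (@L2dist_triangle _ _ _ P (X n) (X (M k)) Y _ _ _))//.
rewrite (le_trans (leeD (hN k _ _ kn (NM k)) (hY k)))// -EFinD lee_fin addrC.
by have := hk _ (leqnn k); move/ltW; apply: le_trans; exact: ler_norm.
Qed.

End L2_convergence.

(** * Riemann-Stieltjes sums along a nondecreasing path *)

Section riemann_stieltjes_path.
Context {R : realType}.
Implicit Types (F f : R -> R) (u w xi eta : nat -> R).

Definition path_sum f F n u xi : R :=
  \sum_(i < n) f (xi i) * (F (u i.+1) - F (u i)).

Definition clamp (a b x : R) : R := Num.min b (Num.max a x).

Lemma clamp_homo a b : {homo clamp a b : x y / x <= y}.
Proof.
move=> x y xy; rewrite /clamp le_min ge_min lexx/= ge_min.
by apply/orP; right; rewrite ge_max !le_max lexx xy orbT.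
Qed.

Lemma clamp_id a b x : a <= x <= b -> clamp a b x = x.
Proof. by move=> /andP[ax xb]; rewrite /clamp (max_r ax) (min_r xb). Qed.

Lemma clamp_left a b x : a <= b -> x <= a -> clamp a b x = a.
Proof. by move=> ab xa; rewrite /clamp (max_l xa) (min_r ab). Qed.

Lemma clamp_right a b x : b <= x -> clamp a b x = b.
Proof. by move=> bx; rewrite /clamp min_l// le_max bx orbT. Qed.

Lemma clamp_itv a b x : a <= b -> a <= clamp a b x <= b.
Proof. by move=> ab; rewrite /clamp ge_min lexx andbT le_min ab le_max lexx. Qed.

(** The F-mass of ]a, b] intersected with ]c, d]; clamping makes it 0 for
    disjoint intervals. *)
Definition overlap F a b c d : R := F (clamp a b d) - F (clamp a b c).

(** Used to exchange the roles of two partitions: the sum of the overlaps over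
    the intervals of either one telescopes. *)
Lemma overlap_sym F a b c d : a <= b -> c <= d ->
  overlap F a b c d = overlap F c d a b.
Proof.
move=> ab cd; rewrite /overlap.
have [bc|cb] := leP b c.
  have bd := le_trans bc cd; have ac := le_trans ab bc.
  by rewrite !(@clamp_right a b)// !(@clamp_left c d)// !subrr.
have [da|ad] := leP d a.
  have ca := le_trans cd da; have db := le_trans da ab.
  by rewrite !(@clamp_left a b)// !(@clamp_right c d)// !subrr.
have -> : clamp a b d = clamp c d b.
  rewrite /clamp (max_r (ltW ad)) (max_r (ltW cb)); exact: minC.
have mb : Num.max a c <= b by rewrite ge_max ab ltW.
have md : Num.max a c <= d by rewrite ge_max cd ltW.
by rewrite /clamp [Num.max c a]maxC (min_r mb) (min_r md).
Qed.

Lemma overlap_ge0 F a b c d : {homo F : x y / x <= y} -> c <= d ->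
  0 <= overlap F a b c d.
Proof. by move=> hF cd; rewrite subr_ge0; apply/hF/clamp_homo. Qed.

Lemma overlap_eq0 F a b c d : a <= b -> c <= d -> (b <= c) || (d <= a) ->
  overlap F a b c d = 0.
Proof.
move=> ab cd /orP[bc|da]; rewrite /overlap.
  by rewrite !clamp_right ?subrr// (le_trans bc).
by rewrite !clamp_left ?subrr// (le_trans cd).
Qed.

Section partitions.
Context (s t mesh : R) (n : nat) (u xi : nat -> R).
Hypothesis up : tagged_partition s t mesh n u xi.

Lemma partition_homo i j : (i <= j)%N -> (j <= n)%N -> u i <= u j.
Proof.
move=> ij; rewrite -(subnKC ij); elim: (j - i)%N => [|k ih]; first by rewrite addn0.
by rewrite addnS => h; rewrite (le_trans (ih (ltnW h)))// ltW// (tp_incr up).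
Qed.

Lemma partition_ge i : (i <= n)%N -> s <= u i.
Proof. by move=> i_n; rewrite -(tp_first up) partition_homo. Qed.

Lemma partition_le i : (i <= n)%N -> u i <= t.
Proof. by move=> i_n; rewrite -[leRHS](tp_last up) partition_homo. Qed.

Lemma partition_step i : (i < n)%N -> u i <= u i.+1.
Proof. by move=> i_n; rewrite ltW// (tp_incr up). Qed.

Lemma overlap_sum F a b : a <= b -> s <= a -> b <= t ->
  \sum_(j < n) overlap F a b (u j) (u j.+1) = F b - F a.
Proof.
move=> ab sa bt; rewrite -(big_mkord xpredT (fun j => overlap F a b (u j) (u j.+1))).
rewrite (telescope_sumr (fun j => F (clamp a b (u j))))//.
by rewrite (tp_first up) (tp_last up) clamp_right// clamp_left.
Qed.

End partitions.

(** Both sums are written as double sums over the overlaps of the intervals of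
    the two partitions, so that no common refinement has to be built: two tags
    are compared only when their intervals meet, and then they are less than
    2 mesh apart. The second alternative of the hypothesis on f describes a
    jump at t; the overlaps concerned lie in a window around t, and the path
    frozen outside that window bounds their total mass. *)
Lemma path_sum_compare f F s v t mesh eps C n u xi m w eta :
  {homo F : x y / x <= y} -> s <= v -> 0 <= eps -> 0 <= C -> 0 < mesh ->
  tagged_partition s v mesh n u xi -> tagged_partition s v mesh m w eta ->
  (forall x y, s <= x <= v -> s <= y <= v -> `|x - y| < 2 * mesh ->
     `|f x - f y| <= eps \/
     [/\ `|x - t| < 2 * mesh, `|y - t| < 2 * mesh & `|f x - f y| <= C]) ->
  `|path_sum f F n u xi - path_sum f F m w eta| <=
    eps * (F v - F s) + C * (F (t + 4 * mesh) - F (t - 4 * mesh)).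
Proof.
move=> hF sv e0 C0 m0 up wp hf.
pose D (i : 'I_n) (j : 'I_m) := overlap F (u i) (u i.+1) (w j) (w j.+1).
have sumD G : \sum_(i < n) \sum_(j < m) overlap G (u i) (u i.+1) (w j) (w j.+1) = G v - G s.
  under eq_bigr => i _ do rewrite (overlap_sum wp _ (partition_step up (ltn_ord i)) (partition_ge up (ltnW (ltn_ord i))) (partition_le up (ltn_ord i))).
  rewrite -(big_mkord xpredT (fun i => G (u i.+1) - G (u i))) telescope_sumr//.
  by rewrite (tp_first up) (tp_last up).
have -> : path_sum f F n u xi = \sum_(i < n) \sum_(j < m) f (xi i) * D i j.
  by apply: eq_bigr => i _; rewrite -mulr_sumr
    (overlap_sum wp _ (partition_step up (ltn_ord i)) (partition_ge up (ltnW (ltn_ord i))) (partition_le up (ltn_ord i))).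
have -> : path_sum f F m w eta = \sum_(i < n) \sum_(j < m) f (eta j) * D i j.
  rewrite exchange_big; apply: eq_bigr => j _ /=; rewrite -mulr_sumr; congr (_ * _).
  rewrite -(overlap_sum up F (partition_step wp (ltn_ord j))).
  - apply: eq_bigr => i _; rewrite /D overlap_sym// ?(partition_step wp)//.
    by rewrite (partition_step up).
  - by rewrite (partition_ge wp)// ltnW.
  - by rewrite (partition_le wp).
(* the path frozen outside the window: the tags are within 2 mesh of t, and the
   overlapping intervals have length at most mesh *)
pose G x := F (clamp (t - 4 * mesh) (t + 4 * mesh) x).
rewrite -sumrB (le_trans (ler_norm_sum _ _ _))//.
under eq_bigr do rewrite -sumrB.
have hG : {homo G : x y / x <= y} by move=> x y xy; apply/hF/clamp_homo.
have Gle : G v - G s <= F (t + 4 * mesh) - F (t - 4 * mesh).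
  rewrite lerB//; apply: hF; have := @clamp_itv (t - 4 * mesh) (t + 4 * mesh).
  - by move=> h; have /andP[] := h v ltac:(lra).
  - by move=> h; have /andP[] := h s ltac:(lra).
apply: (@le_trans _ _ (eps * (F v - F s) + C * (G v - G s))); last first.
  by rewrite lerD2l ler_wpM2l.
rewrite -!sumD !mulr_sumr -big_split; apply: ler_sum => i _ /=.
rewrite (le_trans (ler_norm_sum _ _ _))// !mulr_sumr -big_split; apply: ler_sum => j _ /=.
rewrite -mulrBl normrM.
have ui := partition_step up (ltn_ord i); have wj := partition_step wp (ltn_ord j).
have D0 : 0 <= D i j by exact: overlap_ge0.
have G0 : 0 <= overlap G (u i) (u i.+1) (w j) (w j.+1) by exact: overlap_ge0.
rewrite (ger0_norm D0) -/(D i j).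
have [h|] := boolP ((u i.+1 <= w j) || (w j.+1 <= u i)).
  by rewrite /D overlap_eq0// !mulr0 add0r mulr_ge0.
rewrite negb_or -!ltNge => /andP[h1 h2].
have mu := tp_mesh up (ltn_ord i); have mw := tp_mesh wp (ltn_ord j).
have /andP[x1 x2] := tp_tag up (ltn_ord i); have /andP[y1 y2] := tp_tag wp (ltn_ord j).
have us := partition_ge up (ltnW (ltn_ord i)); have ut := partition_le up (ltn_ord i).
have ws := partition_ge wp (ltnW (ltn_ord j)); have wt := partition_le wp (ltn_ord j).
have [||| h|[h3 h4 h5]] := hf (xi i) (eta j) _ _ _.
- by apply/andP; split; lra.
- by apply/andP; split; lra.
- by rewrite ltr_norml; apply/andP; split; lra.
- by rewrite (le_trans (ler_wpM2r D0 h))// lerDl mulr_ge0.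
have -> : overlap G (u i) (u i.+1) (w j) (w j.+1) = D i j.
  move: h3; rewrite ltr_norml => /andP[h3 h3'].
  rewrite /overlap /G !(@clamp_id (t - 4 * mesh))//.
  - have /andP[c1 c2] := clamp_itv (w j) ui; apply/andP; split; lra.
  - have /andP[c1 c2] := clamp_itv (w j.+1) ui; apply/andP; split; lra.
by rewrite (le_trans (ler_wpM2r D0 h5))// lerDr mulr_ge0.
Qed.

Lemma cat_partition s t v mesh n u xi m w eta :
  tagged_partition s t mesh n u xi -> tagged_partition t v mesh m w eta ->
  let u' i := if (i <= n)%N then u i else w (i - n)%N in
  let xi' i := if (i < n)%N then xi i else eta (i - n)%N in
  tagged_partition s v mesh (n + m) u' xi' /\
  forall f F, path_sum f F (n + m) u' xi' = path_sum f F n u xi + path_sum f F m w eta.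
Proof.
move=> up wp u' xi'.
have u'w i : u' (n + i)%N = w i.
  rewrite /u'; case: ifPn => [|_]; last by rewrite addKn.
  rewrite -{2}(addn0 n) leq_add2l leqn0 => /eqP ->; rewrite addn0.
  by rewrite (tp_last up) (tp_first wp).
have xi'w i : xi' (n + i)%N = eta i by rewrite /xi' ltnNge leq_addr/= addKn.
have u'u i : (i <= n)%N -> u' i = u i by rewrite /u' => ->.
have xi'x i : (i < n)%N -> xi' i = xi i by rewrite /xi' => ->.
split; last first.
  move=> f F; rewrite /path_sum big_split_ord/=; congr (_ + _).
    by apply: eq_bigr => i _ /=; rewrite xi'x// !u'u// ltnW.
  by apply: eq_bigr => i _ /=; rewrite xi'w -addnS !u'w.
have dec i : (i < n + m)%N -> (i < n)%N \/ exists2 j, i = (n + j)%N & (j < m)%N.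
  move=> h; have [|ni] := ltnP i n; [by left|right].
  by exists (i - n)%N; [rewrite subnKC|rewrite ltn_subLR].
split.
- by rewrite u'u// (tp_first up).
- by rewrite u'w (tp_last wp).
- move=> i /dec[h|[j -> h]]; first by rewrite !u'u// ?(ltnW h)// (tp_incr up).
  by rewrite -addnS !u'w (tp_incr wp).
- move=> i /dec[h|[j -> h]]; first by rewrite xi'x// !u'u// ?(ltnW h)// (tp_tag up).
  by rewrite -addnS !u'w xi'w (tp_tag wp).
- move=> i /dec[h|[j -> h]]; first by rewrite !u'u// ?(ltnW h)// (tp_mesh up).
  by rewrite -addnS !u'w (tp_mesh wp).
Qed.

(** With right end points as tags, the sums of a function that vanishes on
    ]s, t] are exactly 0, whatever its value at s. *)
Lemma right_partition s t mesh : s < t -> 0 < mesh ->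
  exists n u, tagged_partition s t mesh n u (fun i => u i.+1).
Proof.
move=> st m0; pose n := (Num.truncn ((t - s) / mesh)).+1.
have n0 : 0 < n%:R :> R by rewrite ltr0n.
pose u (i : nat) : R := s + (t - s) * i%:R / n%:R.
have uS i : u i.+1 - u i = (t - s) / n%:R.
  by rewrite /u -(natr1 i); field; rewrite gt_eqF.
have d0 : 0 < (t - s) / n%:R by rewrite divr_gt0// subr_gt0.
exists n, u; split.
- by rewrite /u mulr0 mul0r addr0.
- by rewrite /u mulfK ?gt_eqF// addrC subrK.
- by move=> i _; rewrite -subr_gt0 uS.
- by move=> i _; rewrite lexx andbT -subr_ge0 uS ltW.
- move=> i _; rewrite uS ltr_pdivrMr// mulrC -ltr_pdivrMr//.
  by rewrite /n truncnS_gt.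
Qed.

End riemann_stieltjes_path.

(** * Exponential decay of stable matrix exponentials *)

Section exponential_generating_function.
Context {R : realType}.
Implicit Types (x y : nat -> R) (t : R).

Definition geometric_growth (c : nat -> R) := exists C L : R,
  [/\ 0 <= C, 0 <= L & forall k, `|c k| <= C * L ^+ k].

(** The entries of exp(t A) are the exponential generating functions of the
    entries of the powers of A. *)
Definition egf (c : nat -> R) t : R := limn (pseries (fun k => c k / k`!%:R) t).

Definition shift_seq (c : nat -> R) : nat -> R := fun k => c k.+1.

Lemma growth_shift (c : nat -> R) : geometric_growth c -> geometric_growth (shift_seq c).
Proof.
move=> [C [L [C0 L0 h]]]; exists (C * L), L; split => // [|k]; first exact: mulr_ge0.
by rewrite -mulrA -exprS h.
Qed.

Lemma growth_lin a b x y : geometric_growth x -> geometric_growth y ->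
  geometric_growth (fun k => a * x k + b * y k).
Proof.
move=> [C [L [C0 L0 h]]] [C' [L' [C'0 L'0 h']]].
exists (`|a| * C + `|b| * C'), (L + L'); split.
- by rewrite addr_ge0// mulr_ge0.
- exact: addr_ge0.
move=> k; rewrite (le_trans (ler_normD _ _))// !normrM mulrDl -!mulrA.
apply: lerD; apply: ler_wpM2l => //.
  by rewrite (le_trans (h k))// ler_wpM2l// lerXn2r ?nnegrE ?addr_ge0// lerDl.
by rewrite (le_trans (h' k))// ler_wpM2l// lerXn2r ?nnegrE ?addr_ge0// lerDr.
Qed.

Lemma is_cvg_egf (c : nat -> R) t : geometric_growth c ->
  cvgn (pseries (fun k => c k / k`!%:R) t).
Proof.
move=> [C [L [C0 L0 h]]].
apply: normed_cvg; apply: (@series_le_cvg _ _ (fun k => C * exp_coeff (L * `|t|) k)).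
- by move=> n /=.
- by move=> n; rewrite mulr_ge0// exp_coeff_ge0// mulr_ge0.
- move=> n /=.
  have -> : `|c n / n`!%:R * t ^+ n| = `|c n| * (`|t| ^+ n / n`!%:R).
    by rewrite !normrM normfV normr_nat normrX mulrAC mulrA.
  rewrite /exp_coeff/= exprMn -!mulrA [leRHS]mulrA.
  by apply: ler_wpM2r; [rewrite divr_ge0// exprn_ge0|exact: h].
- apply: is_cvg_seriesZ; exact: is_cvg_series_exp_coeff.
Qed.

Lemma egf_lin a b x y t : geometric_growth x -> geometric_growth y ->
  egf (fun k => a * x k + b * y k) t = a * egf x t + b * egf y t.
Proof.
move=> gx gy; apply/cvg_lim => //.
have -> : pseries (fun k => (a * x k + b * y k) / k`!%:R) t =
    (fun n => a * pseries (fun k => x k / k`!%:R) t n + b * pseries (fun k => y k / k`!%:R) t n).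
  apply/funext => n; rewrite /pseries /series/= !mulr_sumr -big_split/=.
  by apply: eq_bigr => i _; ring.
by apply: cvgD; apply: cvgMl_tmp; exact: is_cvg_egf.
Qed.

(** Differentiation is the shift on coefficients; this turns the differential
    equations below into linear recurrences. *)
Lemma is_derive_egf (c : nat -> R) t : geometric_growth c ->
  is_derive t 1 (egf c) (egf (shift_seq c) t).
Proof.
move=> gc.
have dE x : pseries_diffs (fun k => x k / k`!%:R) = (fun k => shift_seq x k / k`!%:R).
  apply/funext => k; rewrite /pseries_diffs /shift_seq factS natrM invfM.
  by rewrite mulrCA; congr (_ * _); rewrite mulrA mulfV ?pnatr_eq0// mul1r.
rewrite /egf -dE; apply: (@pseries_snd_diffs _ _ (`|t| + 1)).
- exact: is_cvg_egf.
- by rewrite dE; apply: is_cvg_egf; exact: growth_shift.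
- by rewrite !dE; apply: is_cvg_egf; do 2 apply: growth_shift.
- by rewrite [ltRHS]ger0_norm ?addr_ge0// ltrDl.
Qed.

Lemma egf_continuous (c : nat -> R) : geometric_growth c -> continuous (egf c).
Proof.
move=> gc t; apply: differentiable_continuous; apply/derivable1_diffP.
by have [] := is_derive_egf t gc.
Qed.

Lemma nonincreasing_of_derive (f f' : R -> R) :
  (forall t, is_derive t 1 f (f' t)) -> (forall t, 0 <= t -> f' t <= 0) ->
  forall t, 0 <= t -> f t <= f 0.
Proof.
move=> df f'0 t t0.
have dbl r : derivable f r 1 by have [] := df r.
apply: (@ler0_derive1_le_cc _ f 0 t) => //.
- move=> r; rewrite in_itv/= => /andP[/ltW r0 _].
  by rewrite derive1E (@derive_val _ _ _ _ _ _ _ (df r)) f'0.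
- apply: derivable_within_continuous => x _; exact: dbl.
- by rewrite in_itv/= lexx t0.
- by rewrite in_itv/= lexx.
Qed.

(** For z = al + i be, the equation (X + i Y)' = z (X + i Y) + (G + i H) gives
    N' <= al N - (G^2 + H^2) / al for the energy N = X^2 + Y^2, by
    2 X G <= - al X^2 - G^2 / al. With m = - al, the function
    e^(m t) N - K / (m (m - nu)) e^((m - nu) t) is then nonincreasing. *)
Lemma energy_decay (X Y G H : R -> R) (al be K nu : R) :
  al < 0 -> 0 < nu -> nu < - al -> 0 <= K ->
  (forall t, is_derive t 1 X (G t + al * X t - be * Y t)) ->
  (forall t, is_derive t 1 Y (H t + al * Y t + be * X t)) ->
  (forall t, 0 <= t -> G t ^+ 2 + H t ^+ 2 <= K * expR (- nu * t)) ->
  forall t, 0 <= t -> X t ^+ 2 + Y t ^+ 2 <=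
    (X 0 ^+ 2 + Y 0 ^+ 2 + K / (- al * (- al - nu))) * expR (- nu * t).
Proof.
move=> al0 nu0 nual K0 dX dY hK t t0.
pose m := - al; have m0 : 0 < m by rewrite oppr_gt0.
have mnu : 0 < m - nu by rewrite subr_gt0.
pose D := K / (m * (m - nu)).
have D0 : 0 <= D by rewrite divr_ge0// mulr_ge0// ltW.
have dexp (k s : R) : is_derive s (1 : R) (fun s => expR (k * s)) (k * expR (k * s)).
  have h : is_derive s (1 : R) ( *%R k) k.
    have : is_derive s (1 : R) (k *: (@idfun R)) (k *: (1 : R)) by exact: is_deriveZ.
    by rewrite /GRing.scale/= mulr1.
  rewrite mulrC; exact: (@is_derive1_comp _ expR ( *%R k) s).
pose f (s : R) := expR (m * s) * (X s ^+ 2 + Y s ^+ 2) - D * expR ((m - nu) * s).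
pose f' (s : R) := expR (m * s) * (m * (X s ^+ 2 + Y s ^+ 2)
   + 2 * X s * (G s + al * X s - be * Y s) + 2 * Y s * (H s + al * Y s + be * X s))
   - D * (m - nu) * expR ((m - nu) * s).
have df (s : R) : is_derive s 1 f (f' s).
  have := dX s; have := dY s; have := dexp m s; have := dexp (m - nu) s.
  move=> d1 d2 d3 d4.
  have -> : f = (fun s => expR (m * s)) * (X * X + Y * Y) - D *: (fun s => expR ((m - nu) * s)).
    by apply/funext => x; rewrite /f !expr2.
  apply: is_derive_eq; rewrite /f' /GRing.scale/= /GRing.scale/=.
  have -> : (X * X + Y * Y) s = X s * X s + Y s * Y s by [].
  ring.
have f'0 (s : R) : 0 <= s -> f' s <= 0.
  move=> s0; rewrite /f'.
  have -> : expR ((m - nu) * s) = expR (m * s) * expR (- nu * s) by rewrite -expRD; congr expR; ring.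
  have -> : D * (m - nu) = K / m.
    by rewrite /D; field; rewrite !gt_eqF.
  rewrite [X in _ - X]mulrCA -mulrBr pmulr_rle0 ?expR_gt0//.
  have h := hK s s0.
  rewrite subr_le0 [leRHS]mulrAC ler_pdivlMr//.
  apply: le_trans h.
  have := sqr_ge0 (m * X s - G s); have := sqr_ge0 (m * Y s - H s).
  rewrite /m; nra.
have := nonincreasing_of_derive df f'0 t0; rewrite /f !mulr0 expR0 !mul1r mulr1.
move=> h.
have h2 : expR (m * t) * (X t ^+ 2 + Y t ^+ 2) <= X 0 ^+ 2 + Y 0 ^+ 2 + D * expR ((m - nu) * t).
  have : 0 <= D by []. lra.
have e1 : 1 <= expR ((m - nu) * t) by rewrite -expR0 ler_expR mulr_ge0// ltW.
rewrite -(ler_pM2l (expR_gt0 (m * t))) mulrCA -expRD.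
have -> : m * t + - nu * t = (m - nu) * t by ring.
rewrite (le_trans h2)// [leRHS]mulrDl; apply: lerD; last by [].
by rewrite ler_peMr// addr_ge0 ?sqr_ge0.
Qed.

Local Notation CR := (complex R).

Definition shift_sub (c : nat -> CR) (z : CR) : nat -> CR := fun k => c k.+1 - z * c k.

Definition re_seq (c : nat -> CR) k : R := complex.Re (c k).
Definition im_seq (c : nat -> CR) k : R := complex.Im (c k).

(** On generating functions [shift_sub] by z is the operator d/dt - z. Induction
    on the list of roots: the decay of (d/dt - z) f is that of the source term
    in [energy_decay], which gives the decay of f, at a possibly smaller rate. *)
Lemma egf_decay (zs : seq CR) (c : nat -> CR) :
  (forall z, z \in zs -> complex.Re z < 0) ->
  geometric_growth (re_seq c) -> geometric_growth (im_seq c) ->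
  foldl shift_sub c zs =1 (fun=> 0) ->
  exists K nu : R, [/\ 0 <= K, 0 < nu & forall t, 0 <= t ->
    egf (re_seq c) t ^+ 2 + egf (im_seq c) t ^+ 2 <= K * expR (- nu * t)].
Proof.
elim: zs c => [|z zs ih] c hz gr gi /= c0.
  exists 0, 1; split => // t t0; rewrite mul0r.
  have e0 x : (x =1 fun=> 0) -> egf x t = 0.
    move=> x0; have -> : x = (fun k => 0 * (0 : R) + 0 * 0) by apply/funext => k; rewrite x0 !mul0r addr0.
    rewrite (@egf_lin 0 0 (fun=> 0) (fun=> 0)) ?mul0r ?addr0//;
      by exists 0, 0; split => // k; rewrite normr0 mul0r.
  by rewrite !e0 ?expr0n ?addr0// => k; rewrite /re_seq /im_seq c0.
case: z hz c0 => al be hz c0.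
have al0 : al < 0 by apply: (hz (Complex al be)); rewrite inE eqxx.
pose g := shift_sub c (Complex al be).
have gre : re_seq g = (fun k => 1 * (1 * re_seq (fun i => c i.+1) k + (- al) * re_seq c k)
                     + be * im_seq c k).
  by apply/funext => k; rewrite /re_seq /im_seq /g /shift_sub; case: (c k) (c k.+1) => a b [a' b'] /=; ring.
have gim : im_seq g = (fun k => 1 * (1 * im_seq (fun i => c i.+1) k + (- al) * im_seq c k)
                     + (- be) * re_seq c k).
  by apply/funext => k; rewrite /re_seq /im_seq /g /shift_sub; case: (c k) (c k.+1) => a b [a' b'] /=; ring.
have gsr : geometric_growth (re_seq (fun i => c i.+1)) by exact: growth_shift gr.
have gsi : geometric_growth (im_seq (fun i => c i.+1)) by exact: growth_shift gi.
have ggr : geometric_growth (re_seq g).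
  by rewrite gre; do 2 (apply: growth_lin => //).
have ggi : geometric_growth (im_seq g).
  by rewrite gim; do 2 (apply: growth_lin => //).
have [K [mu [K0 mu0 hK]]] : exists K nu : R, [/\ 0 <= K, 0 < nu & forall t, 0 <= t ->
    egf (re_seq g) t ^+ 2 + egf (im_seq g) t ^+ 2 <= K * expR (- nu * t)].
  by apply: ih => // z zzs; apply: hz; rewrite inE zzs orbT.
(* [energy_decay] needs a rate below - al *)
pose nu := Num.min mu (- al / 2).
have nu0 : 0 < nu by rewrite lt_min mu0 divr_gt0// oppr_gt0.
have nual : nu < - al by rewrite gt_min; apply/orP; right; lra.
have numu : nu <= mu by rewrite ge_min lexx.
exists (egf (re_seq c) 0 ^+ 2 + egf (im_seq c) 0 ^+ 2 + K / (- al * (- al - nu))), nu; split => //.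
  by rewrite addr_ge0 ?addr_ge0 ?sqr_ge0// divr_ge0// mulr_ge0 ?subr_ge0 ?ltW// oppr_gt0.
apply: (@energy_decay _ _ (egf (re_seq g)) (egf (im_seq g)) al be) => //.
- move=> t; have -> : egf (re_seq g) t + al * egf (re_seq c) t - be * egf (im_seq c) t
     = egf (shift_seq (re_seq c)) t; last exact: is_derive_egf.
  rewrite gre !egf_lin//; last by apply: growth_lin.
  by rewrite (_ : re_seq (fun i => c i.+1) = shift_seq (re_seq c))//; ring.
- move=> t; have -> : egf (im_seq g) t + al * egf (im_seq c) t + be * egf (re_seq c) t
     = egf (shift_seq (im_seq c)) t; last exact: is_derive_egf.
  rewrite gim !egf_lin//; last by apply: growth_lin.
  by rewrite (_ : im_seq (fun i => c i.+1) = shift_seq (im_seq c))//; ring.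
move=> t t0; rewrite (le_trans (hK t t0))// ler_wpM2l// ler_expR.
by rewrite !mulNr lerN2 ler_wpM2r.
Qed.

End exponential_generating_function.

Section stable_matrix_exponential.
Context {R : realType}.
Local Notation CR := (complex R).

Lemma expmx_egf n (A : 'M[R]_n) t i j :
  expmx (t *: A) i j = egf (fun k => (A ^+ k) i j) t.
Proof.
case: n A i j => [A []//|n] A i j.
rewrite mxE /egf /pseries; congr (limn (series _)).
apply/funext => k.
have -> : (t *: A) ^+ k = t ^+ k *: A ^+ k.
  elim: k => [|k ih]; first by rewrite !expr0 scale1r.
  by rewrite !exprS ih -scalerAl -scalerAr scalerA.
by rewrite mxE mulrAC mulrC mulrA mulrAC.
Qed.

Lemma growth_mxpow n (A : 'M[R]_n) i j : geometric_growth (fun k => (A ^+ k) i j).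
Proof.
case: n A i j => [A []//|n] A i j.
pose L := \sum_k \sum_l `|A k l|.
have L0 : 0 <= L by apply: sumr_ge0 => k _; apply: sumr_ge0.
exists 1, L; split => // k; rewrite mul1r.
elim: k i j => [|k ih] i j; first by rewrite !expr0 mxE; case: (i == j); rewrite ?normr1 ?normr0.
rewrite exprSr mxE (le_trans (ler_norm_sum _ _ _))//.
rewrite (@le_trans _ _ (\sum_l L ^+ k * `|A l j|))//.
  by apply: ler_sum => l _; rewrite normrM ler_wpM2r.
rewrite -mulr_sumr exprSr ler_wpM2l ?exprn_ge0//.
apply: ler_sum => l _; rewrite (bigD1 j)//= lerDl sumr_ge0//.
Qed.

(** With Q = 1 and the eigenvalues of A, counted with multiplicity, the product
    is 0 by Cayley-Hamilton: this is the recurrence satisfied by the entries of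
    the powers of A. *)
Lemma foldl_shift_sub_mxpow n (A Q : 'M[CR]_n.+1) (zs : seq CR) i j :
  foldl shift_sub (fun k => (Q * A ^+ k) i j) zs =
  (fun k => (Q * \prod_(z <- zs) (A - z%:M) * A ^+ k) i j).
Proof.
elim: zs Q => [|z zs ih] Q /=; first by rewrite big_nil mulr1.
rewrite big_cons mulrA -ih; congr foldl; apply/funext => k.
have -> : Q * (A - z%:M) * A ^+ k = Q * A ^+ k.+1 - z *: (Q * A ^+ k).
  by rewrite mulrBr mulrBl exprS mulrA -scalemx1 -scalerAr mulr1 -scalerAl.
by rewrite /shift_sub [RHS]mxE [X in _ = _ + X]mxE [X in _ = _ - X]mxE.
Qed.

Lemma stable_mxpow_decay n (A : 'M[R]_n.+1) i j : spectrum_negative A ->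
  exists K nu : R, [/\ 0 <= K, 0 < nu & forall t, 0 <= t ->
    `|egf (fun k => (A ^+ k) i j) t| <= K * expR (- nu * t)].
Proof.
move=> hA; pose AC : 'M[CR]_n.+1 := map_mx (real_complex R) A.
have [zs] := closed_field_poly_normal (char_poly AC).
rewrite (monicP (char_poly_monic AC)) scale1r => pE.
have ch : \prod_(z <- zs) (AC - z%:M) = 0.
  rewrite -(Cayley_Hamilton AC) pE rmorph_prod; apply: eq_bigr => z _ /=.
  by rewrite rmorphB/= horner_mx_X horner_mx_C.
pose c k := (1 * AC ^+ k) i j.
have cE k : c k = Complex ((A ^+ k) i j) 0.
  by rewrite /c mul1r -[AC ^+ k]rmorphXn/= mxE.
have rE : re_seq c = (fun k => (A ^+ k) i j) by apply/funext => k; rewrite /re_seq cE.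
have iE : im_seq c = (fun=> 0) by apply/funext => k; rewrite /im_seq cE.
have [z zzs||||K [nu [K0 nu0 h]]] := @egf_decay R zs c.
- by apply: hA; rewrite eigenvalue_root_char -/AC pE root_prod_XsubC.
- by rewrite rE; exact: growth_mxpow.
- by rewrite iE; exists 0, 0; split => // k; rewrite normr0 mul0r.
- move=> k; rewrite foldl_shift_sub_mxpow ch mulr0 mul0r; exact: mxE.
(* [egf_decay] bounds the square *)
exists (Num.sqrt K), (nu / 2); split; first exact: sqrtr_ge0.
  by rewrite divr_gt0.
move=> t t0; have := h t t0; rewrite rE => {}h.
have h' : egf (fun k => (A ^+ k) i j) t ^+ 2 <= K * expR (- nu * t).
  by apply: le_trans h; rewrite lerDl sqr_ge0.
rewrite -(ler_pXn2r (ltn0Sn 1)) ?nnegrE ?mulr_ge0 ?sqrtr_ge0 ?expR_ge0//.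
rewrite real_normK ?num_real// exprMn sqr_sqrtr// (le_trans h')// ler_wpM2l//.
by rewrite expr2 -expRD ler_expR le_eqVlt; apply/orP; left; apply/eqP; field.
Qed.

(** Multiplying by e selects the last column of the exponential. *)
Lemma state_kernelP p (a : nat -> R) (i : 'I_p) :
  spectrum_negative (carma_mx p a) ->
  let f x := (expmx (x *: carma_mx p a) *m carma_e p) i ord0 in
  continuous f /\ exists K nu : R, [/\ 0 <= K, 0 < nu & forall x, 0 <= x ->
    `|f x| <= K * expR (- nu * x)].
Proof.
case: p i => [[]//|p] i; move: (carma_mx p.+1 a) => A hA f.
have fE : f = (fun x => egf (fun k => (A ^+ k) i ord_max) x).
  apply/funext => x; rewrite /f mxE (bigD1 ord_max)//= big1 ?addr0 => [|k kn].
    by rewrite [carma_e _ _ _]mxE eqxx mulr1 expmx_egf.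
  rewrite [carma_e _ _ _]mxE eqSS; case: eqP => [kp|_]; last by rewrite mulr0.
  by rewrite -val_eqE/= kp eqxx in kn.
split; first by rewrite fE; apply: egf_continuous; exact: growth_mxpow.
by rewrite fE; exact: stable_mxpow_decay.
Qed.

End stable_matrix_exponential.

(** * Moments of the increments of the driver *)

Section nonnegative_integrals.
Context {d : measure_display} {T : measurableType d} {R : realType}.
Variable mu : {measure set T -> \bar R}.

(** The integral of a nonnegative function is a supremum over the simple
    functions below it. In this form the comparison applies directly to the
    density of the mean measure, which is given by its values on the blocks. *)
Lemma le_integral_no_measurability (D : set T) (f g : T -> \bar R) :
  (forall x, D x -> 0 <= f x)%E -> (forall x, D x -> f x <= g x)%E ->
  (\int[mu]_(x in D) f x <= \int[mu]_(x in D) g x)%E.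
Proof.
move=> f0 fg.
have g0 x : D x -> (0 <= g x)%E by move=> Dx; exact: le_trans (f0 x Dx) (fg x Dx).
rewrite !ge0_integralE//; apply: ge_ereal_sup => _ [h hf <-].
apply: ereal_sup_ubound; exists h => // x; rewrite (le_trans (hf x))//.
by apply: lee_restrict.
Qed.

End nonnegative_integrals.

Section periodic_intensity_bound.
Context {R : realType}.

(** Every value of rho is one of the r ratios lam_j / ell_j. *)
Lemma intensity_bounded (r : nat) (s lam : nat -> R) (rho : R -> R) :
  periodic_blocks r s lam -> periodic_intensity r s lam rho ->
  exists2 K, 0 <= K & forall x, 0 <= rho x <= K.
Proof.
move=> pb hi.
have len0 i : 0 < block_length s i by rewrite subr_gt0 (pb_s_incr pb).
pose t i := lam i / block_length s i.
have t0 i : 0 <= t i by rewrite divr_ge0// ltW// (pb_lam_gt0 pb).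
have tper i : t i = t (i %% r)%N.
  by rewrite /t {1 2}(divn_eq i r) addnC (pb_lam pb) (pb_length pb).
have T0 : 0 < period r s.
  case: r pb {hi tper} => [/pb_r_gt0//|r pb].
  rewrite /period big_ord_recl ltr_wpDr//; apply: sumr_ge0 => i _; exact: ltW.
have rho_shift x k : rho (x + k%:R * period r s) = rho x.
  elim: k => [|k ih]; first by rewrite mul0r addr0.
  by rewrite -natr1 mulrDl mul1r addrA (pi_periodic hi).
exists (\sum_(j < r) t j); first by apply: sumr_ge0 => j _.
move=> x.
(* enough periods to move x to the positive half-line, which the blocks cover *)
pose k := (Num.truncn (`|x| / period r s)).+1.
have xk : 0 < x + k%:R * period r s.
  rewrite -ltrBlDl sub0r (le_lt_trans (ler_norm _))// normrN -ltr_pdivrMr//.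
  exact: truncnS_gt.
rewrite -(rho_shift x k).
have : (\bigcup_i block s i) (x + k%:R * period r s).
  by rewrite (pb_cover pb)/= in_itv/= xk.
move=> [i _ /(pi_block hi)->]; rewrite -/(t i) tper t0/=.
have ir : (i %% r < r)%N by rewrite ltn_mod (pb_r_gt0 pb).
by rewrite (bigD1 (Ordinal ir))//= lerDl sumr_ge0.
Qed.

Lemma mean_measure_bound (rho : R -> R) (K u v : R) : u <= v -> 0 <= K ->
  (forall x, 0 <= rho x <= K) ->
  (0 <= mean_measure rho `]u, v] <= (K * (v - u))%:E)%E.
Proof.
move=> uv K0 hrho; apply/andP; split.
  by apply: integral_ge0 => x _; rewrite lee_fin; have /andP[] := hrho x.
rewrite /mean_measure.
apply: (@le_trans _ _ (\int[lebesgue_measure]_(x in `]u, v]) (cst K%:E x))%E).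
  by apply: le_integral_no_measurability => x _; rewrite lee_fin; have /andP[] := hrho x.
rewrite integral_cst//= lebesgue_measure_itv/= lte_fin; case: ifPn => [_|].
  by rewrite -EFinD -EFinM.
by rewrite mule0 lee_fin => _; rewrite mulr_ge0// subr_ge0.
Qed.

End periodic_intensity_bound.

Section poisson_moments.
Context {R : realType}.

Lemma poisson_prob1 (L : R) k :
  poisson_prob L 0%N [set k] = if 0 < L then (poisson_pmf L k)%:E else \d_0%N [set k].
Proof.
rewrite /poisson_prob; case: ifPn => // L0.
by rewrite esum_set1// lee_fin poisson_pmf_ge0.
Qed.

Lemma poisson_prob_total (L : R) : (\sum_(k <oo) poisson_prob L 0%N [set k] = 1)%E.
Proof.
have <- : poisson_prob L 0%N setT = 1%E by exact: probability_setT.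
have <- : \bigcup_k [set k] = [set: nat].
  by apply/seteqP; split => // k _; exists k.
rewrite measure_bigcup//; first by apply: eq_eseriesl => k; rewrite in_setT.
by move=> i j _ _ [k [<- <-]].
Qed.

(** Since k^2 / k! = k / (k - 1)! and k <= 2^(k - 1), the series is at most
    L e^-L times that of e^(2 L). The factor L makes the bound vanish with the
    length of the window. *)
Lemma poisson_second_moment (L : R) : 0 <= L ->
  (\sum_(k <oo) ((k%:R ^+ 2)%:E * poisson_prob L 0%N [set k]) <= (L * expR L)%:E)%E.
Proof.
move=> L0.
have p0 k : (0 <= (k%:R ^+ 2)%:E * poisson_prob L 0%N [set k])%E.
  by rewrite mule_ge0// lee_fin sqr_ge0.
have [Lpos|] := ltP 0 L; last first.
  move=> L0'; have -> : L = 0 by apply/eqP; rewrite eq_le L0 L0'.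
  rewrite mul0r eseries0//= => k _ _; rewrite poisson_prob1 ltxx diracE.
  case: k => [|k]; first by rewrite expr0n mul0e.
  by rewrite memNset ?mule0.
pose e k : R := (L * expR (- L)) * exp_coeff (2 * L) k.
have e0 k : 0 <= e k.
  by rewrite mulr_ge0 ?exp_coeff_ge0 ?mulr_ge0 ?expR_ge0.
have e_sum : series e @ \oo --> L * expR L.
  have -> : L * expR L = (L * expR (- L)) * expR (2 * L).
    by rewrite -mulrA -expRD; congr (_ * expR _); ring.
  have -> : series e = (fun n => (L * expR (- L)) * series (exp_coeff (2 * L)) n).
    by apply/funext => n; rewrite /series/= mulr_sumr.
  by apply: cvgMl_tmp; exact: is_cvg_series_exp_coeff.
have -> : (L * expR L)%:E = (\sum_(k <oo) (e k)%:E)%E.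
  apply/esym/cvg_lim => //.
  have -> : (fun n => \sum_(0 <= k < n) (e k)%:E)%E = EFin \o series e.
    by apply/funext => n; rewrite /= sumEFin.
  by apply: cvg_EFin e_sum; exact: nearW.
rewrite (nneseries_recl (fun k _ => p0 k))//.
rewrite [X in (X + _)%E](_ : _ = 0%E); last by rewrite expr2 mulr0 mul0e.
rewrite add0e -(nneseries_addn 1)//.
apply: lee_nneseries => // k _.
rewrite poisson_prob1 Lpos -EFinM lee_fin /poisson_pmf Lpos /e /exp_coeff/=.
have -> : (k + 1)%N = k.+1 by rewrite addn1.
have -> : k.+1%:R ^+ 2 * (L ^+ k.+1 / (k.+1)`!%:R * expR (- L)) =
    (L * expR (- L) * L ^+ k / k`!%:R) * k.+1%:R :> R.
  have k0 : k.+1%:R != 0 :> R by rewrite pnatr_eq0.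
  have f0 : k`!%:R != 0 :> R by rewrite pnatr_eq0 -lt0n fact_gt0.
  rewrite factS natrM [L ^+ _]exprS; move: (k.+1%:R) (k`!%:R) (L ^+ k) k0 f0 => x y z x0 y0.
  by field; rewrite x0 y0.
have -> : L * expR (- L) * ((2 * L) ^+ k / k`!%:R) =
    (L * expR (- L) * L ^+ k / k`!%:R) * 2 ^+ k by rewrite exprMn; field; rewrite pnatr_eq0 -lt0n fact_gt0.
rewrite ler_wpM2l//; last by rewrite -natrX ler_nat ltn_expl.
by rewrite divr_ge0// mulr_ge0 ?exprn_ge0// mulr_ge0 ?expR_ge0.
Qed.

End poisson_moments.

(** The sum of the e_i (m_i - z)^2 is nonnegative; take z = S / k, where S is
    the sum of the e_i m_i. *)
Lemma indicator_cauchy_schwarz (R : realType) n (e : nat -> bool) (m : nat -> R) (k : R) :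
  \sum_(i < n) (e i)%:R <= k ->
  (\sum_(i < n) (e i)%:R * m i) ^+ 2 <= k * \sum_(i < n) (e i)%:R * m i ^+ 2.
Proof.
set C := \sum_(i < n) _ => Ck; set S := (\sum_(i < n) _ * m i); set Q := (\sum_(i < n) _ * _ ^+ 2).
have h (z : R) : 0 <= Q - 2 * z * S + z ^+ 2 * C.
  have -> : Q - 2 * z * S + z ^+ 2 * C = \sum_(i < n) (e i)%:R * (m i - z) ^+ 2.
    rewrite /Q /S /C !mulr_sumr -sumrB -big_split/=; apply: eq_bigr => i _; ring.
  by apply: sumr_ge0 => i _; rewrite mulr_ge0 ?sqr_ge0.
have C0 : 0 <= C by apply: sumr_ge0.
have [k0|k0] := ltP 0 k.
  rewrite mulrC -ler_pdivrMr//.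
  have := h (S / k); have : (S / k) ^+ 2 * C <= (S / k) ^+ 2 * k by rewrite ler_wpM2l ?sqr_ge0.
  have -> : (S / k) ^+ 2 * k = S ^+ 2 / k by field; rewrite gt_eqF.
  have -> : 2 * (S / k) * S = 2 * (S ^+ 2 / k) by field; rewrite gt_eqF.
  lra.
have {}C0 : C = 0 by apply/eqP; rewrite eq_le C0 (le_trans Ck k0).
have e0 (i : 'I_n) : (e i)%:R = 0 :> R.
  apply/eqP; move/eqP: C0; rewrite psumr_eq0// => /allP/(_ i); rewrite mem_index_enum.
  by apply.
have -> : S = 0 by rewrite /S big1// => i _; rewrite e0 mul0r.
have -> : Q = 0 by rewrite /Q big1// => i _; rewrite e0 mul0r.
by rewrite expr0n mulr0.
Qed.

Section marked_poisson_increments.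
Context {d : measure_display} {T : measurableType d} {R : realType}.
Variable P : probability T R.

Lemma measurable_sigma_generated (I : Type) (X : I -> T -> R) i :
  measurable_fun setT
    (X i : g_sigma_algebraType (\bigcup_(i in setT) preimage_set_system setT (X i) measurable) -> R).
Proof.
move=> _ B mB; rewrite setTI; apply: sub_sigma_algebra; exists i => //.
by exists B => //; rewrite setTI.
Qed.

(** Both sides integrate g against the same measure, the image under m of the
    restriction of P to A. *)
Lemma integral_independent (m J : {RV P >-> R}) (A : set T) (g : R -> \bar R) :
  measurable A -> measurable_fun setT g -> (forall x, 0 <= g x)%E ->
  (forall B, measurable B -> P (m @^-1` B) = P (J @^-1` B)) ->
  (forall B, measurable B -> P (m @^-1` B `&` A) = (P (m @^-1` B) * P A)%E) ->
  (\int[P]_(w in A) g (m w) = P A * \int[P]_w g (J w))%E.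
Proof.
move=> mA mg g0 hJ hI.
have mm : measurable_fun setT (m : T -> measurableTypeR R) by exact: (@measurable_funPT _ _ _ _ m).
have mJ : measurable_fun setT (J : T -> measurableTypeR R) by exact: (@measurable_funPT _ _ _ _ J).
have PA : (0 <= fine (P A)) by exact: fine_ge0.
have PAE : ((NngNum PA)%:num%:E = P A)%E by rewrite /= fineK// fin_num_measure.
have -> : (\int[P]_(w in A) g (m w) = \int[mrestr P mA]_w g (m w))%E.
  have mC : measurable (~` A) by exact: measurableC.
  rewrite [RHS](@ge0_negligible_integral _ _ _ _ _ (~` A))//=; last 2 first.
  - exact: measurableT_comp.
  - by rewrite /mrestr setICl measure0.
  rewrite setTD setCK; apply: eq_measure_integral => B mB BA.
  by rewrite /= /mrestr setIidl.
have /= := ge0_integral_pushforward mm (mrestr P mA) (f := g) measurableT mg.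
rewrite preimage_setT => <-//.
have /= := ge0_integral_pushforward mJ P (f := g) measurableT mg.
rewrite preimage_setT => <-//.
rewrite -PAE -ge0_integral_mscale//; apply: eq_measure_integral => B mB _.
rewrite /= /mscale/= /pushforward /mrestr -hJ//.
by rewrite hI// fineK ?fin_num_measure// muleC.
Qed.

(** The increments of S are sums over sets of indices, with value 0 when
    infinitely many terms are nonzero; a finite number of atoms rules this out. *)
Lemma finite_of_nneseries (F : set nat) (k : nat) :
  (\sum_(n <oo) (\1_F n : R)%:E = k%:R%:E)%E -> finite_set F.
Proof.
move=> h; have := @counting_dirac R F.
have -> : (\sum_(n <oo) \d_n F = k%:R%:E :> \bar R)%E.
  by rewrite -h; apply: eq_eseriesr => n _; rewrite diracE indicE.
by rewrite /counting; case: ifPn => // /asboolP.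
Qed.

Variable rho : R -> R.
Variables (M : R.-ker T ~> measurableTypeR R) (J : {RV P >-> R})
  (atom mark : nat -> {RV P >-> R}).
Hypotheses (hM : poisson_random_measure P (mean_measure rho) M)
  (hJ : (J : T -> R) \in Lfun P 2%:E) (hm : iid_marked_atoms M J atom mark).

Section window.
Variables (u v : R).
Let B : set (measurableTypeR R) := `]u, v]%classic.
Let mB : measurable B := measurable_itv _.
Let N k : set T := [set w | M w B = k%:R%:E].
Let A n k : set T := (atom n @^-1` B) `&` N k.

Lemma count_atoms w : M w B = (\sum_(n <oo) (\1_(atom n @^-1` B) w)%:E)%E.
Proof.
by rewrite (ma_atoms hm).
Qed.

Lemma measurable_atom_event n k :
  sigma_generated setT (fun n => atom n : T -> R) (A n k).
Proof.
rewrite /sigma_generated.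
set G := (\bigcup_(i in setT) _).
have mX i : measurable_fun setT (atom i : g_sigma_algebraType G -> R).
  exact: (@measurable_sigma_generated _ (fun n => atom n : T -> R) i).
have mi i : measurable (atom i @^-1` B : set (g_sigma_algebraType G)).
  by rewrite -[X in measurable X]setTI; exact: mX.
have mN : measurable (N k : set (g_sigma_algebraType G)).
  have mc : measurable_fun setT (fun w : g_sigma_algebraType G =>
      \sum_(n <oo) (\1_(atom n @^-1` B) w : R)%:E)%E.
    apply: ge0_emeasurable_sum => [i w _ _|i _]; first by rewrite lee_fin.
    by apply/measurable_EFinP; exact: measurable_indic.
  rewrite (_ : N k = (fun w => \sum_(n <oo) (\1_(atom n @^-1` B) w : R)%:E)%E @^-1` [set k%:R%:E]).
    by rewrite -[X in measurable X]setTI; exact: mc.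
  by apply/seteqP; split=> w; rewrite /N/= count_atoms.
exact: (measurableI _ _ (mi n) mN).
Qed.

Lemma measurable_count k : measurable (N k).
Proof.
rewrite -[X in measurable X]setTI.
have := @measurable_kernel _ _ _ _ _ M B mB.
by move=> /(_ measurableT [set k%:R%:E]); apply; exact: emeasurable_set1.
Qed.

Lemma measurable_A n k : measurable (A n k).
Proof.
apply: measurableI; last exact: measurable_count.
by rewrite -[X in measurable X]setTI; exact: (measurable_funP (atom n)).
Qed.

Lemma integral_mark_sqr n k :
  (\int[P]_(w in A n k) (mark n w ^+ 2)%:E = P (A n k) * \int[P]_w (J w ^+ 2)%:E)%E.
Proof.
apply: (@integral_independent _ _ _ (fun x => (x ^+ 2)%:E)).
- exact: measurable_A.
- by apply/measurable_EFinP; exact: measurable_funX.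
- by move=> x; rewrite lee_fin sqr_ge0.
- by move=> C mC; exact: (ma_mark_law hm).
move=> C mC; apply: (ma_mark_atom_indep hm); last exact: measurable_atom_event.
by apply: sub_sigma_algebra; exists n => //; exists C => //; rewrite setTI.
Qed.

(** On the event that there are k atoms in the window, the number of atoms is
    the sum of the indicators of the events that the n-th atom is in it. *)
Lemma sum_prob_A k : (\sum_(n <oo) P (A n k) = k%:R%:E * P (N k))%E.
Proof.
have mN := measurable_count k.
transitivity (\int[P]_(w in N k) (\sum_(n <oo) (\1_(atom n @^-1` B) w)%:E))%E.
  rewrite integral_nneseries//; last first.
    move=> n; apply/measurable_EFinP/measurable_funTS/measurable_indic.
    by rewrite -[X in measurable X]setTI; exact: (measurable_funP (atom n)).
  apply: eq_eseriesr => n _; rewrite integral_indic//.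
  by rewrite -[X in measurable X]setTI; exact: (measurable_funP (atom n)).
transitivity (\int[P]_(w in N k) (cst k%:R%:E w))%E; last by rewrite integral_cst.
by apply: eq_integral => w; rewrite inE /N/= count_atoms.
Qed.

Let L := fine (mean_measure rho B).
Hypothesis L0 : (0 <= mean_measure rho B)%E.
Hypothesis Loo : (mean_measure rho B < +oo)%E.

Lemma prob_count k : P (N k) = poisson_prob L 0%N [set k].
Proof. by rewrite (prm_law hM mB Loo). Qed.

Lemma ae_count_finite : {ae P, forall w, exists k, N k w}.
Proof.
have mU : measurable (\bigcup_k N k) by apply: bigcup_measurable => k _; exact: measurable_count.
have tN : trivIset setT N.
  move=> i j _ _ [w [Ni Nj]].
  by have [/eqP] := etrans (esym Ni) Nj; rewrite eqr_nat => /eqP.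
have mN k : setT k -> measurable (N k) by move=> _; exact: measurable_count.
exists (~` \bigcup_k N k); split.
- exact: measurableC.
- rewrite probability_setC// measure_bigcup//.
  rewrite (eq_eseriesl _ (Q := xpredT)); last by move=> k; rewrite in_setT.
  have -> : (\sum_(k <oo) P (N k) = \sum_(k <oo) poisson_prob L 0%N [set k])%E.
    by apply: eq_eseriesr => k _; exact: prob_count.
  by rewrite poisson_prob_total subee.
- by move=> w /= nk [k _ Nk]; apply: nk; exists k.
Qed.

Let sum_marks w := \sum_(n \in [set n | u < atom n w <= v]) mark n w.

(** A series of nonnegative terms, so that its expectation can be computed term
    by term; in each term the event depends on the atoms only and is therefore
    independent of the mark. On the event that there are k atoms it is k times
    the sum of the squared marks. *)
Definition square_majorant w : \bar R :=
  (\sum_(k <oo) \sum_(n <oo) (k%:R * (\1_(A n k) w * mark n w ^+ 2))%:E)%E.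

Lemma sum_marks_sqr_le k w : N k w -> ((sum_marks w ^+ 2)%:E <= square_majorant w)%E.
Proof.
move=> Nk.
pose e n := (u < atom n w <= v).
have eE n : \1_(atom n @^-1` B) w = (e n)%:R :> R.
  by rewrite indicE /e; congr ((_ : bool)%:R); apply/idP/idP; rewrite inE /B/= in_itv.
have cnt : (\sum_(n <oo) ((e n)%:R : R)%:E = k%:R%:E)%E.
  transitivity (M w B); last exact: Nk.
  by rewrite count_atoms; apply: eq_eseriesr => n _; rewrite eE.
have finF : finite_set [set n | e n].
  apply: (@finite_of_nneseries _ k); rewrite -cnt; apply: eq_eseriesr => n _.
  by rewrite indicE; congr (((_ : bool)%:R)%:E); apply/idP/idP; rewrite inE.
have [K hK] : exists K, forall n, e n -> (n < K)%N.
  exists (\max_(n <- finmap.enum_fset (fset_set [set n | e n])) n).+1 => n en.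
  by rewrite ltnS leq_bigmax_seq// in_fset_set// inE.
have -> : sum_marks w = \sum_(n < K) (e n)%:R * mark n w.
  rewrite (fsbig_ord _ _ (fun n => (e n)%:R * mark n w)) /sum_marks.
  rewrite -(@fsbig_widen _ _ _ _ [set n | e n] `I_K (fun n => (e n)%:R * mark n w)).
  - by apply: eq_fsbigr => n; rewrite inE /= -/(e n) => ->; rewrite mul1r.
  - by move=> n /= en; exact: hK.
  - by move=> n /= [_ /negP/negbTE ->]; rewrite mul0r.
have hC : \sum_(n < K) (e n)%:R <= k%:R :> R.
  rewrite -lee_fin -cnt -sumEFin -(big_mkord xpredT (fun n => ((e n)%:R)%:E)).
  by apply: (nneseries_lim_ge (P := xpredT)) => n _ _; rewrite lee_fin.
have := @indicator_cauchy_schwarz R K e (fun n => mark n w) k%:R hC.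
rewrite -lee_fin => /le_trans; apply.
have pos j n : (0 <= (j%:R * (\1_(A n j) w * mark n w ^+ 2))%:E)%E.
  by rewrite lee_fin; apply: mulr_ge0 => //; apply: mulr_ge0 => //; exact: sqr_ge0.
apply: (@le_trans _ _ (\sum_(n <oo) (k%:R * (\1_(A n k) w * mark n w ^+ 2))%:E)%E); last first.
  have pos' j : true -> (0 <= \sum_(n <oo) (j%:R * (\1_(A n j) w * mark n w ^+ 2))%:E)%E.
    by move=> _; apply: nneseries_ge0 => n _ _; exact: pos.
  rewrite /square_majorant (@nneseriesD1 _ _ k xpredT pos')// leeDl//.
  by apply: nneseries_ge0 => j _ _; exact: pos'.
apply: le_trans (nneseries_lim_ge K _); last by move=> n _ _.
rewrite mulr_sumr -sumEFin big_mkord; apply: lee_sum => n _.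
rewrite lee_fin ler_wpM2l// ler_wpM2r ?sqr_ge0//.
rewrite indicE /A in_setI (mem_set Nk) andbT.
by have := eE n; rewrite indicE => ->.
Qed.

Lemma integral_majorant :
  (\int[P]_w square_majorant w <= ((L * expR L))%:E * \int[P]_w (J w ^+ 2)%:E)%E.
Proof.
have pos j n w : (0 <= (j%:R * (\1_(A n j) w * mark n w ^+ 2))%:E)%E.
  by rewrite lee_fin; apply: mulr_ge0 => //; apply: mulr_ge0 => //; exact: sqr_ge0.
have mterm j n : measurable_fun setT (fun w => (j%:R * (\1_(A n j) w * mark n w ^+ 2))%:E).
  apply/measurable_EFinP; apply: measurable_funM => //; apply: measurable_funM.
    exact/measurable_indic/measurable_A.
  exact: measurable_funX.
have J0 : (0 <= \int[P]_w (J w ^+ 2)%:E)%E.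
  by apply: integral_ge0 => w _; rewrite lee_fin sqr_ge0.
have [j2 j2E] : exists j2 : R, (\int[P]_w (J w ^+ 2)%:E = j2%:E)%E.
  exists (fine (\int[P]_w (J w ^+ 2)%:E)%E); rewrite fineK// ge0_fin_numE//.
  have mJ := Lfun2_measurable hJ.
  by rewrite -L2norm_sqr; apply: poweR_lty; rewrite -Lfun2P.
rewrite integral_nneseries//; first last.
- by move=> k w _; exact: nneseries_ge0.
- by move=> k; apply: ge0_emeasurable_sum.
have -> : (\sum_(k <oo) \int[P]_w (\sum_(n <oo) (k%:R * (\1_(A n k) w * mark n w ^+ 2))%:E)
   = \sum_(k <oo) (\int[P]_w (J w ^+ 2)%:E * ((k%:R ^+ 2)%:E * poisson_prob L 0%N [set k])))%E.
  apply: eq_eseriesr => k _.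
  rewrite integral_nneseries//.
  have -> : (\sum_(n <oo) \int[P]_w (k%:R * (\1_(A n k) w * mark n w ^+ 2))%:E =
     \sum_(n <oo) (k%:R%:E * \int[P]_w (J w ^+ 2)%:E * P (A n k)))%E.
    apply: eq_eseriesr => n _.
    under eq_integral do rewrite EFinM.
    rewrite ge0_integralZl//; first last.
    + by move=> w _; rewrite lee_fin mulr_ge0 ?sqr_ge0.
    + apply/measurable_EFinP/measurable_funM; first exact/measurable_indic/measurable_A.
      exact: measurable_funX.
    rewrite -muleA; congr (_ * _)%E; rewrite muleC -integral_mark_sqr.
    rewrite [RHS]integral_mkcond; apply: eq_integral => w _.
    by rewrite patchE indicE; case: ifPn => _; rewrite ?mul1r ?mul0r.
  rewrite j2E -EFinM nneseriesZl//=.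
  rewrite EFinM sum_prob_A prob_count expr2 EFinM.
  by rewrite (muleC k%:R%:E j2%:E) !muleA.
rewrite j2E in J0 *.
rewrite nneseriesZl//=; last by move=> k _; rewrite mule_ge0// lee_fin sqr_ge0.
rewrite muleC lee_wpmul2r//; apply: poisson_second_moment.
exact: fine_ge0.
Qed.

End window.
End marked_poisson_increments.

Section increment_modulus.
Context {d : measure_display} {T : measurableType d} {R : realType}.
Variable P : probability T R.

(** Together with the monotony of the paths and the second moments, this is the
    information on S from which the integrals below are built. *)
Record increment_modulus (S : R -> {RV P >-> R}) (om : R -> R) : Prop := {
  im_bound : forall u v, u <= v ->
    (L2norm P (fun w => S v w - S u w)%R <= (om (v - u)%R)%:E)%E ;
  im_ge0 : forall l, 0 <= om l ;
  im_homo : forall l l', 0 <= l -> l <= l' -> om l <= om l' ;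
  im_small : forall e : R, 0 < e -> exists2 dl : R, 0 < dl & om dl <= e }.

Lemma compound_increment_moment (rho : R -> R) (K : R)
  (M : R.-ker T ~> measurableTypeR R) (J : {RV P >-> R})
  (atom mark : nat -> {RV P >-> R}) (gamma : R) (S : R -> {RV P >-> R}) u v :
  poisson_random_measure P (mean_measure rho) M ->
  (J : T -> R) \in Lfun P 2%:E -> iid_marked_atoms M J atom mark ->
  compound_path gamma atom mark S -> 0 <= K -> (forall x, 0 <= rho x <= K) -> u < v ->
  (\int[P]_w ((S v w - S u w) ^+ 2)%:E <=
   (2 * gamma ^+ 2 * (v - u) ^+ 2)%:E +
   (2 * (K * (v - u) * expR (K * (v - u))))%:E * \int[P]_w (J w ^+ 2)%:E)%E.
Proof.
move=> hM hJ hm hS K0 hrho uv.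
have /andP[L0 LK] := mean_measure_bound (ltW uv) K0 hrho.
have Loo : (mean_measure rho `]u, v] < +oo)%E by exact: le_lt_trans LK (ltry _).
have LE : mean_measure rho `]u, v] = (fine (mean_measure rho `]u, v]))%:E.
  by rewrite fineK// ge0_fin_numE.
set L := fine _ in LE.
have {}LK : L <= K * (v - u) by rewrite LE lee_fin in LK.
have L0' : 0 <= L by rewrite LE lee_fin in L0.
have J0 : (0 <= \int[P]_w (J w ^+ 2)%:E)%E.
  by apply: integral_ge0 => w _; rewrite lee_fin sqr_ge0.
pose Q w := square_majorant M atom mark u v w.
have Q0 w : (0 <= Q w)%E.
  apply: nneseries_ge0 => k _ _; apply: nneseries_ge0 => n _ _.
  by rewrite lee_fin; apply: mulr_ge0 => //; apply: mulr_ge0 => //; exact: sqr_ge0.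
have mQ : measurable_fun setT Q.
  apply: ge0_emeasurable_sum => [k w _ _|k _].
    apply: nneseries_ge0 => n _ _.
    by rewrite lee_fin; apply: mulr_ge0 => //; apply: mulr_ge0 => //; exact: sqr_ge0.
  apply: ge0_emeasurable_sum => [n w _ _|n _].
    by rewrite lee_fin; apply: mulr_ge0 => //; apply: mulr_ge0 => //; exact: sqr_ge0.
  apply/measurable_EFinP; apply: measurable_funM => //; apply: measurable_funM.
    exact/measurable_indic/measurable_A.
  exact: measurable_funX.
have c0 : 0 <= 2 * gamma ^+ 2 * (v - u) ^+ 2.
  by apply: mulr_ge0; [apply: mulr_ge0 => //|]; exact: sqr_ge0.
apply: (@le_trans _ _ (\int[P]_w ((2 * gamma ^+ 2 * (v - u) ^+ 2)%:E + 2%:E * Q w))%E).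
  apply: ae_ge0_le_integral => //.
  - by move=> w _; rewrite lee_fin sqr_ge0.
  - by apply/measurable_EFinP; apply: measurable_funX; apply: measurable_funB.
  - by move=> w _; apply: adde_ge0; [rewrite lee_fin|apply: mule_ge0; rewrite ?lee_fin].
  - by apply: emeasurable_funD => //; apply: measurable_funeM.
  have := ae_count_finite (u := u) (v := v) hM Loo.
  apply: filterS2 hS => w [_ hw] [k Nk] _.
  rewrite hw//.
  have h := sum_marks_sqr_le hm Nk.
  set s := \sum_(n \in _) _ in h *.
  apply: (@le_trans _ _ (2 * gamma ^+ 2 * (v - u) ^+ 2 + 2 * s ^+ 2)%:E).
    by rewrite lee_fin; have := sqr_ge0 (gamma * (v - u) - s); nra.
  by rewrite EFinD leeD2l// EFinM lee_wpmul2l.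
rewrite ge0_integralD//; last 2 first.
- by move=> w _; apply: mule_ge0; rewrite ?lee_fin.
- exact: measurable_funeM.
rewrite integral_cst//= probability_setT mule1 leeD2l//.
rewrite ge0_integralZl// EFinM -muleA lee_wpmul2l//.
apply: (le_trans (integral_majorant hM hJ hm L0 Loo)).
rewrite lee_wpmul2r// lee_fin ler_pM ?expR_ge0//.
by rewrite ler_expR.
Qed.

Lemma increment_modulusP (r : nat) (s lam : nat -> R) (rho : R -> R)
  (M : R.-ker T ~> measurableTypeR R) (J : {RV P >-> R})
  (atom mark : nat -> {RV P >-> R}) (gamma : R) (S : R -> {RV P >-> R}) :
  periodic_blocks r s lam -> periodic_intensity r s lam rho ->
  poisson_random_measure P (mean_measure rho) M ->
  (J : T -> R) \in Lfun P 2%:E -> iid_marked_atoms M J atom mark ->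
  compound_path gamma atom mark S ->
  exists om, increment_modulus S om.
Proof.
move=> hb hi hM hJ hm hS.
have [K K0 hrho] := intensity_bounded hb hi.
have J0 : (0 <= \int[P]_w (J w ^+ 2)%:E)%E.
  by apply: integral_ge0 => w _; rewrite lee_fin sqr_ge0.
have [j2 j2E] : exists j2 : R, (\int[P]_w (J w ^+ 2)%:E = j2%:E)%E.
  exists (fine (\int[P]_w (J w ^+ 2)%:E)%E); rewrite fineK// ge0_fin_numE//.
  have mJ := Lfun2_measurable hJ.
  by rewrite -L2norm_sqr; apply: poweR_lty; rewrite -Lfun2P.
have j20 : 0 <= j2 by rewrite -lee_fin -j2E.
pose q l := 2 * gamma ^+ 2 * l ^+ 2 + 2 * (K * l * expR (K * l)) * j2.
have q0 l : 0 <= l -> 0 <= q l.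
  move=> l0; have := expR_ge0 (K * l) => e0.
  have g2 := sqr_ge0 gamma; have l2 := sqr_ge0 l.
  by rewrite /q; move: (gamma ^+ 2) (l ^+ 2) g2 l2 => x y x0 y0; rewrite addr_ge0 ?mulr_ge0.
have qS l l' : 0 <= l -> l <= l' -> q l <= q l'.
  move=> l0 ll'; have l'0 := le_trans l0 ll'.
  have Kl : K * l <= K * l' by rewrite ler_wpM2l.
  rewrite lerD//.
    by apply: ler_wpM2l; [apply: mulr_ge0 => //; exact: sqr_ge0|rewrite lerXn2r ?nnegrE].
  rewrite ler_wpM2r// ler_wpM2l// ler_pM ?mulr_ge0 ?expR_ge0//.
  by rewrite ler_expR.
have cq : continuous q.
  move=> l; apply: cvgD; first by apply: cvgMl_tmp; exact: exprn_continuous.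
  apply: cvgMr_tmp; apply: cvgMl_tmp; apply: cvgM; first by apply: cvgMl_tmp.
  apply: continuous_comp; last exact: continuous_expR.
  by apply: cvgMl_tmp.
pose om l := Num.sqrt (q l).
have com : continuous om.
  by move=> l; apply: (@continuous_comp _ _ _ q Num.sqrt); [exact: cq|exact: sqrt_continuous].
have om0 : om 0 = 0 by rewrite /om /q expr0n !mulr0 !mul0r mulr0 mul0r addr0 sqrtr0.
exists om; split.
- move=> u v; rewrite le_eqVlt => /predU1P[->|uv].
    rewrite (_ : (fun w => _) = (fun=> 0)) ?L2norm0 ?lee_fin ?sqrtr_ge0//.
    by apply/funext => w; rewrite subrr.
  rewrite L2norm_leP ?sqrtr_ge0// sqr_sqrtr ?q0 ?subr_ge0 ?(ltW uv)//.
  rewrite (le_trans (compound_increment_moment hM hJ hm hS K0 hrho uv))//.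
  by rewrite j2E -EFinM -EFinD.
- by move=> l; exact: sqrtr_ge0.
- by move=> l l' l0 ll'; rewrite ler_wsqrtr// qS.
- move=> e e0.
  have := com 0; move/cvgrPdist_lt => /(_ e e0).
  rewrite om0 => -[dl /= dl0 h].
  exists (dl / 2); first by rewrite divr_gt0.
  have := h (dl / 2); rewrite /ball_/= !sub0r !normrN.
  rewrite (gtr0_norm (divr_gt0 dl0 (ltr0n _ 2))) (ger0_norm (sqrtr_ge0 _)).
  by move=> /(_ _)/ltW; apply; rewrite ltr_pdivrMr// ltr_pMr// ltr1n.
Qed.

End increment_modulus.

(** * Integrals over bounded intervals *)

Lemma Lfun2D (d : measure_display) (T : measurableType d) (R : realType)
    (P : probability T R) (X Y : T -> R) (c : R) :
  X \in Lfun P 2%:E -> Y \in Lfun P 2%:E ->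
  (fun w => X w + c * Y w) \in Lfun P 2%:E.
Proof.
move=> LX LY; have mX := Lfun2_measurable LX; have mY := Lfun2_measurable LY.
have mcY : measurable_fun setT (fun w => c * Y w) by exact: measurable_funM.
have mXY : measurable_fun setT (fun w => X w + c * Y w) by exact: measurable_funD.
rewrite Lfun2P// (le_lt_trans (L2norm_triangle P mX mcY))//.
rewrite lte_add_pinfty -?Lfun2P//.
rewrite Lfun2P// L2normZ// lte_mul_pinfty ?lee_fin//.
by rewrite -Lfun2P.
Qed.

Lemma Lfun2_0 (d : measure_display) (T : measurableType d) (R : realType)
    (P : probability T R) : (fun _ : T => 0 : R) \in Lfun P 2%:E.
Proof. by rewrite Lfun2P// L2norm0 ltry. Qed.

Section truncated_kernel.
Context {R : realType}.
Implicit Types (g : R -> R) (s t v : R).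

(** The kernel u |-> h(t - u) has this form: a continuous function cut off after
    t, with the value at t kept. *)
Definition truncate g t : R -> R := fun u => g u * (u <= t)%R%:R.

Lemma truncate_id g t u : u <= t -> truncate g t u = g u.
Proof. by move=> ut; rewrite /truncate ut mulr1. Qed.

Lemma truncate_eq0 g t u : t < u -> truncate g t u = 0.
Proof. by move=> tu; rewrite /truncate leNgt tu mulr0. Qed.

Lemma continuous_bounded_itv g s v : continuous g -> s <= v ->
  exists2 C, 0 <= C & forall u, s <= u <= v -> `|g u| <= C.
Proof.
move=> cg sv.
have cn : {within `[s, v], continuous (fun u => `|g u|)}.
  by apply: continuous_subspaceT => u; apply: cvg_norm; exact: cg.
have [c _ hc] := EVT_max sv cn.
by exists `|g c| => // u suv; apply: hc; rewrite in_itv.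
Qed.

Lemma continuous_unif_itv g s v : continuous g -> s <= v ->
  forall e : R, 0 < e -> exists2 dl : R, 0 < dl &
    forall x y, s <= x <= v -> s <= y <= v -> `|x - y| < dl -> `|g x - g y| <= e.
Proof.
move=> cg sv e e0.
have K : compact `[s, v]%classic by exact: segment_compact.
have := (compact_near_coveringP _).1 K R (0 : R)^'+
  (fun dl x => forall y, `|x - y| < dl -> `|g x - g y| <= e) _.
case.
  move=> x _.
  have e20 : 0 < e / 2 by rewrite divr_gt0.
  have := cg x; move/cvgrPdist_lt => /(_ _ e20)[et /= et0 h].
  exists (ball x (et / 2), [set dl | dl < et / 2]) => /=.
    split; first by apply: nbhsx_ballx; rewrite divr_gt0.
    by apply: nbhs_right_lt; rewrite divr_gt0.
  move=> [z dl]/= [xz dle] y zy.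
  have hz : `|g x - g z| < e / 2.
    apply: h; rewrite /ball_/=; apply: lt_trans xz _.
    by rewrite ltr_pdivrMr// ltr_pMr// ltr1n.
  have hy : `|g x - g y| < e / 2.
    apply: h; rewrite /ball_/= -(subrKA z) (le_lt_trans (ler_normD _ _))//.
    by have := ltrD xz (lt_trans zy dle); rewrite -splitr.
  rewrite -(subrKA (g x)) (le_trans (ler_normD _ _))// distrC.
  by have := ltrD hz hy; rewrite -splitr => /ltW.
move=> dl /= dl0 h.
exists (dl / 2); first by rewrite divr_gt0.
move=> x y hx _ xy; apply: (h (dl / 2)) => //=.
- rewrite sub0r normrN gtr0_norm ?divr_gt0//.
  by rewrite ltr_pdivrMr// ltr_pMr// ltr1n.
- by rewrite divr_gt0.
Qed.

End truncated_kernel.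

Lemma ge_min_l (R : realType) (x y : R) : Num.min x y <= x.
Proof. by rewrite ge_min lexx. Qed.

Lemma ge_min_r (R : realType) (x y : R) : Num.min x y <= y.
Proof. by rewrite ge_min lexx orbT. Qed.

Section L2_riemann_stieltjes.
Context {d : measure_display} {T : measurableType d} {R : realType}.
Variable P : probability T R.
Variable S : R -> {RV P >-> R}.
Implicit Types (f g : R -> R) (s t v : R) (I : T -> R).

Lemma RS_sumE f n u xi w : RS_sum S f n u xi w = path_sum f (fun x => S x w) n u xi.
Proof. by []. Qed.

Lemma Lfun2_increment (hS : second_order_subordinator S) u v : (fun w => S v w - S u w) \in Lfun P 2%:E.
Proof.
rewrite (_ : (fun w => _) = (fun w => S v w + (-1) * S u w)).
  by apply: Lfun2D; exact: (sub_moment2 hS).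
by apply/funext => w; rewrite mulN1r.
Qed.

Lemma RS_sum_Lfun2 (hS : second_order_subordinator S) f n u xi : RS_sum S f n u xi \in Lfun P 2%:E.
Proof.
elim: n => [|n ih].
  rewrite (_ : RS_sum S f 0 u xi = fun=> 0); first exact: Lfun2_0.
  by apply/funext => w; rewrite /RS_sum big_ord0.
rewrite (_ : RS_sum S f n.+1 u xi =
    fun w => RS_sum S f n u xi w + f (xi n) * (S (u n.+1) w - S (u n) w)).
  by apply: Lfun2D => //; exact: Lfun2_increment.
by apply/funext => w; rewrite /RS_sum big_ord_recr.
Qed.

Lemma tagged_partitionW s v m m' n (u xi : nat -> R) : m <= m' ->
  tagged_partition s v m n u xi -> tagged_partition s v m' n u xi.
Proof.
move=> mm' [a b c e h]; split => // i i_n; exact: lt_le_trans (h i i_n) mm'.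
Qed.

Lemma is_RS_integral_Lfun f s v I : is_RS_integral S f s v I -> I \in Lfun P 2%:E.
Proof. by case. Qed.

Lemma eq_RS_integral f g s v I : (forall u, s <= u <= v -> f u = g u) ->
  is_RS_integral S f s v I -> is_RS_integral S g s v I.
Proof.
move=> fg [LI hI]; split => // e e0; have [dl dl0 h] := hI e e0.
exists dl => // n u xi up; have := h n u xi up.
rewrite (_ : RS_sum S g n u xi = RS_sum S f n u xi)//.
apply/funext => w; apply: eq_bigr => i _; rewrite fg//.
have /andP[a b] := tp_tag up (ltn_ord i).
have := partition_ge up (ltnW (ltn_ord i)); have := partition_le up (ltn_ord i).
by move=> ? ?; apply/andP; split; lra.
Qed.

Lemma RS_integral_right f s v I : s < v -> is_RS_integral S f s v I ->
  forall e : R, 0 < e -> exists2 dl : R, 0 < dl & forall m, 0 < m -> m <= dl ->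
    exists n u, tagged_partition s v m n u (fun i => u i.+1) /\
      (L2_dist P (RS_sum S f n u (fun i => u i.+1)) I < e%:E)%E.
Proof.
move=> sv [_ hI] e e0; have [dl dl0 h] := hI e e0; exists dl => // m m0 mdl.
have [n [u up]] := right_partition sv m0; exists n, u; split => //.
by apply: h; exact: tagged_partitionW up.
Qed.

Section subordinator.
Variable om : R -> R.
Hypotheses (hS : second_order_subordinator S) (hom : increment_modulus S om).

Let mS t : measurable_fun setT (S t). Proof. exact: measurable_funPT. Qed.

Lemma RS_integral_addZ f g c s v I J :
  is_RS_integral S f s v I -> is_RS_integral S g s v J ->
  is_RS_integral S (fun u => f u + c * g u) s v (fun w => I w + c * J w).
Proof.
move=> [LI hI] [LJ hJ]; split=> [|e e0]; first exact: Lfun2D.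
have e20 : 0 < e / 2 by rewrite divr_gt0.
have c0 : 0 < `|c| + 1 by rewrite ltr_wpDl.
have [d1 d10 h1] := hI _ e20.
have [d2 d20 h2] := hJ _ (divr_gt0 e20 c0).
exists (Num.min d1 d2) => [|n u xi up]; first by rewrite lt_min d10.
have {}h1 := h1 n u xi (tagged_partitionW (ge_min_l _ _) up).
have {}h2 := h2 n u xi (tagged_partitionW (ge_min_r _ _) up).
set A := RS_sum S f n u xi in h1; set B := RS_sum S g n u xi in h2.
have mA : measurable_fun setT A by apply: Lfun2_measurable; exact: RS_sum_Lfun2.
have mB : measurable_fun setT B by apply: Lfun2_measurable; exact: RS_sum_Lfun2.
have mI := Lfun2_measurable LI; have mJ := Lfun2_measurable LJ.
have mAI : measurable_fun setT (A \- I) by exact: measurable_funB.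
have mBJ : measurable_fun setT (B \- J) by exact: measurable_funB.
have mcBJ : measurable_fun setT (fun w => c * (B \- J) w) by exact: measurable_funM.
rewrite L2distE (_ : _ \- _ = (A \- I) \+ (fun w => c * (B \- J) w)); last first.
  apply/funext => w /=; rewrite /A /B /RS_sum.
  have -> : \sum_(i < n) (f (xi i) + c * g (xi i)) * (S (u i.+1) w - S (u i) w)
    = \sum_(i < n) f (xi i) * (S (u i.+1) w - S (u i) w)
      + c * \sum_(i < n) g (xi i) * (S (u i.+1) w - S (u i) w).
    by rewrite mulr_sumr -big_split; apply: eq_bigr => i _ /=; ring.
  ring.
rewrite (le_lt_trans (L2norm_triangle P mAI mcBJ))// L2normZ//.
apply: (@lt_le_trans _ _ ((e / 2)%:E + `|c|%:E * (e / 2 / (`|c| + 1))%:E)%E).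
  apply: lte_leD => //.
    rewrite fin_numM// ge0_fin_numE ?L2norm_ge0//.
    exact: lt_trans h2 (ltry _).
  by rewrite lee_wpmul2l ?lee_fin// ltW.
rewrite -EFinM -EFinD lee_fin.
have : `|c| * (e / 2 / (`|c| + 1)) <= e / 2.
  by rewrite mulrCA ler_piMr ?(ltW e20)// ler_pdivrMr// mul1r lerDl.
lra.
Qed.

(** Concatenating right-tagged partitions of the two halves gives partitions of
    the whole interval. *)
Lemma RS_integral_split f s t v I I1 I2 : s < t -> t < v ->
  is_RS_integral S f s v I -> is_RS_integral S f s t I1 -> is_RS_integral S f t v I2 ->
  {ae P, forall w, I w = I1 w + I2 w}.
Proof.
move=> st tv hI hI1 hI2.
have mI := Lfun2_measurable (is_RS_integral_Lfun hI).
have mI1 := Lfun2_measurable (is_RS_integral_Lfun hI1).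
have mI2 := Lfun2_measurable (is_RS_integral_Lfun hI2).
apply: (ae_of_L2dist0 mI (measurable_funD mI1 mI2)) => e e0.
have e30 : 0 < e / 3 by rewrite divr_gt0.
have [dl dl0 h] := hI.2 _ e30.
have [dl1 dl10 h1] := RS_integral_right st hI1 e30.
have [dl2 dl20 h2] := RS_integral_right tv hI2 e30.
pose m := Num.min dl (Num.min dl1 dl2).
have m0 : 0 < m by rewrite !lt_min dl0 dl10.
have [ml ml1 ml2] : [/\ m <= dl, m <= dl1 & m <= dl2].
  by rewrite !ge_min !lexx !orbT.
have [n1 [u1 [p1 q1]]] := h1 m m0 ml1.
have [n2 [u2 [p2 q2]]] := h2 m m0 ml2.
have [up E] := cat_partition p1 p2.
have := h _ _ _ (tagged_partitionW ml up).
set u := (fun i => _); set xi := (fun i => _) => q.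
have RE : RS_sum S f (n1 + n2) u xi = RS_sum S f n1 u1 (fun i => u1 i.+1) \+ RS_sum S f n2 u2 (fun i => u2 i.+1).
  by apply/funext => w; rewrite /= !RS_sumE E.
set A := RS_sum S f n1 _ _ in RE q1; set B := RS_sum S f n2 _ _ in RE q2.
have mA : measurable_fun setT A by apply: Lfun2_measurable; exact: RS_sum_Lfun2.
have mB : measurable_fun setT B by apply: Lfun2_measurable; exact: RS_sum_Lfun2.
rewrite (le_trans (L2dist_triangle P mI (measurable_funD mA mB) (measurable_funD mI1 mI2)))//.
have dAB : (L2_dist P (A \+ B)%R (I1 \+ I2)%R <= L2_dist P A I1 + L2_dist P B I2)%E.
  rewrite !L2distE (_ : (A \+ B)%R \- _ = (A \- I1) \+ (B \- I2)).
    by apply: L2norm_triangle; exact: measurable_funB.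
  by apply/funext => w /=; ring.
have q' : (L2_dist P I (A \+ B)%R <= (e / 3)%:E)%E by rewrite -RE L2dist_sym ltW.
rewrite (le_trans (leeD q' (le_trans dAB (leeD (ltW q1) (ltW q2)))))//.
by rewrite -!EFinD lee_fin; lra.
Qed.

Lemma RS_integral_eq0 f s v I : s < v -> (forall u, s < u <= v -> f u = 0) ->
  is_RS_integral S f s v I -> {ae P, forall w, I w = 0}.
Proof.
move=> sv f0 hI.
have mI := Lfun2_measurable (is_RS_integral_Lfun hI).
apply: (ae_of_L2dist0 mI (measurable_cst (0 : R))) => e e0.
have [dl dl0 h] := RS_integral_right sv hI e0.
have [n [u [up q]]] := h dl dl0 (lexx _).
rewrite L2dist_sym (_ : cst 0 = RS_sum S f n u (fun i => u i.+1)); first exact: ltW.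
apply/funext => w; rewrite /RS_sum big1// => i _; rewrite f0 ?mul0r//.
rewrite (partition_le up (ltn_ord i)) andbT.
by rewrite (le_lt_trans (partition_ge up (ltnW (ltn_ord i))))// (tp_incr up).
Qed.

Lemma RS_integral_norm f s v I c : s < v -> 0 <= c ->
  (forall u, s <= u <= v -> `|f u| <= c) ->
  is_RS_integral S f s v I -> (L2norm P I <= (c * om (v - s))%:E)%E.
Proof.
move=> sv c0 fc hI.
have mI := Lfun2_measurable (is_RS_integral_Lfun hI).
apply/lee_addgt0Pr => e e0.
have [dl dl0 h] := RS_integral_right sv hI e0.
have [n [u [up q]]] := h dl dl0 (lexx _).
set A := RS_sum S f n _ _ in q.
have mA : measurable_fun setT A by apply: Lfun2_measurable; exact: RS_sum_Lfun2.
rewrite (_ : I = A \+ (I \- A)); last by apply/funext => w /=; ring.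
rewrite (le_trans (L2norm_triangle P mA (measurable_funB mI mA)))//.
apply: leeD; last by rewrite -L2distE L2dist_sym ltW.
have mi : measurable_fun setT (fun w => S v w - S s w) by exact: measurable_funB.
apply: (@le_trans _ _ (L2norm P (fun w => c * (S v w - S s w)))).
  apply: L2norm_le_ae => //; first exact: measurable_funM.
  apply: filterS (sub_nondecreasing hS) => w hw /=.
  rewrite [leRHS]ger0_norm; last by rewrite mulr_ge0// subr_ge0 hw// ltW.
  rewrite /A /RS_sum (le_trans (ler_norm_sum _ _ _))//.
  apply: (@le_trans _ _ (\sum_(i < n) c * (S (u i.+1) w - S (u i) w))).
    apply: ler_sum => i _.
    have ui : S (u i) w <= S (u i.+1) w by apply: hw; exact: (partition_step up).
    rewrite normrM [X in _ * X <= _]ger0_norm ?subr_ge0// ler_wpM2r ?subr_ge0//.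
    by rewrite fc// (partition_ge up (ltn_ord i)) (partition_le up (ltn_ord i)).
  rewrite -mulr_sumr -(big_mkord xpredT (fun i => S (u i.+1) w - S (u i) w)).
  by rewrite (telescope_sumr (fun i => S (u i) w))// (tp_first up) (tp_last up).
rewrite L2normZ// ger0_norm// EFinM lee_wpmul2l ?lee_fin//.
by apply: (im_bound hom); exact: ltW.
Qed.

(** The jump of the truncated kernel at t is the second alternative of
    [path_sum_compare]. *)
Lemma RS_sum_cauchy g t s v : continuous g -> s < v -> forall e : R, 0 < e ->
  exists2 dl : R, 0 < dl & forall n u xi m w eta,
    tagged_partition s v dl n u xi -> tagged_partition s v dl m w eta ->
    (L2_dist P (RS_sum S (truncate g t) n u xi) (RS_sum S (truncate g t) m w eta) <= e%:E)%E.
Proof.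
move=> cg sv e e0.
have [C C0 gC] := continuous_bounded_itv cg (ltW sv).
pose eps := e / (2 * (om (v - s) + 1)).
have om1 : 0 < om (v - s) + 1 by rewrite ltr_wpDl// (im_ge0 hom).
have eps0 : 0 < eps by rewrite divr_gt0// mulr_gt0.
have [dl1 dl10 h1] := continuous_unif_itv cg (ltW sv) eps0.
have C1 : 0 < 2 * (C + 1) by rewrite mulr_gt0// ltr_wpDl.
have [dl2 dl20 h2] := im_small hom (divr_gt0 e0 C1).
(* tags are compared up to distance 2 dl, and the window around t has length
   8 dl *)
pose dl := Num.min (dl1 / 2) (dl2 / 8).
have dl0 : 0 < dl by rewrite lt_min !divr_gt0.
have dldl1 : 2 * dl <= dl1.
  have : dl <= dl1 / 2 by rewrite ge_min lexx. lra.
have dldl2 : 8 * dl <= dl2.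
  have : dl <= dl2 / 8 by rewrite ge_min lexx orbT. lra.
exists dl => // n u xi m w eta up wp.
set X := RS_sum _ _ _ _ _; set Y := RS_sum _ _ m _ _.
have mX : measurable_fun setT X by apply: Lfun2_measurable; exact: RS_sum_Lfun2.
have mY : measurable_fun setT Y by apply: Lfun2_measurable; exact: RS_sum_Lfun2.
have mi a b : measurable_fun setT (fun w => S b w - S a w) by exact: measurable_funB.
pose Z1 w := eps * (S v w - S s w).
pose Z2 w := C * (S (t + 4 * dl) w - S (t - 4 * dl) w).
have mZ1 : measurable_fun setT Z1 by exact: measurable_funM.
have mZ2 : measurable_fun setT Z2 by exact: measurable_funM.
have le4 : t - 4 * dl <= t + 4 * dl by lra.
apply: (@le_trans _ _ (L2norm P (Z1 \+ Z2))).
  rewrite L2distE; apply: L2norm_le_ae; [exact: measurable_funB|exact: measurable_funD|].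
  apply: filterS (sub_nondecreasing hS) => o ho /=.
  rewrite [leRHS]ger0_norm; last first.
    by rewrite addr_ge0// mulr_ge0// ?(ltW eps0)// subr_ge0 ho// ltW.
  apply: (@path_sum_compare _ (truncate g t) (fun x => S x o) s v t dl eps C
    n u xi m w eta) => //; try exact: ltW.
  move=> x y hx hy xy; rewrite /truncate.
  have [xt|tx] := leP x t; have [yt|ty] := leP y t; rewrite ?mulr1 ?mulr0 ?subr0 ?sub0r ?normrN.
  - by left; apply: h1 => //; exact: lt_le_trans xy dldl1.
  - right; split; last exact: gC.
    + by rewrite ler0_norm ?subr_le0//; move: xy; rewrite distrC ger0_norm; lra.
    + by rewrite gtr0_norm ?subr_gt0//; move: xy; rewrite distrC ger0_norm; lra.
  - right; split; last exact: gC.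
    + by rewrite gtr0_norm ?subr_gt0//; move: xy; rewrite ger0_norm; lra.
    + by rewrite ler0_norm ?subr_le0//; move: xy; rewrite ger0_norm; lra.
  - by left; rewrite normr0 ltW.
rewrite (le_trans (L2norm_triangle P mZ1 mZ2))//.
rewrite !L2normZ// (gtr0_norm eps0) (ger0_norm C0).
apply: (@le_trans _ _ (eps%:E * (om (v - s))%:E + C%:E * (om dl2)%:E)%E).
  apply: leeD; rewrite lee_wpmul2l ?lee_fin ?(ltW eps0)//.
    by apply: (im_bound hom); exact: ltW.
  rewrite (le_trans (im_bound hom le4))// lee_fin (im_homo hom)//; lra.
rewrite -!EFinM -EFinD lee_fin.
have : eps * om (v - s) <= e / 2.
  have -> : eps * om (v - s) = e / 2 * (om (v - s) / (om (v - s) + 1)).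
    by rewrite /eps; field; rewrite gt_eqF.
  by rewrite ler_piMr ?divr_ge0 ?(ltW e0)// ler_pdivrMr// mul1r lerDl.
have : C * om dl2 <= e / 2.
  apply: (@le_trans _ _ (C * (e / (2 * (C + 1))))); first by rewrite ler_wpM2l.
  have C10 : 0 < C + 1 by rewrite ltr_wpDl.
  have -> : C * (e / (2 * (C + 1))) = e / 2 * (C / (C + 1)) by field; rewrite gt_eqF.
  by rewrite ler_piMr ?divr_ge0 ?(ltW e0)// ler_pdivrMr// mul1r lerDl.
lra.
Qed.

Lemma RS_integral_exists g t s v : continuous g -> s < v ->
  exists I, is_RS_integral S (truncate g t) s v I.
Proof.
move=> cg sv.
pose mesh (n : nat) : R := n.+1%:R^-1.
have mesh0 n : 0 < mesh n by rewrite invr_gt0.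
have /choice[N hN] n := right_partition sv (mesh0 n).
have /choice[U hU] := hN.
pose X n := RS_sum S (truncate g t) (N n) (U n) (fun i => U n i.+1).
have mesh_small (e : R) : 0 < e -> exists k, forall n, (k <= n)%N -> mesh n <= e.
  move=> e0; exists (Num.truncn e^-1) => n kn.
  rewrite /mesh -[leRHS]invrK lef_pV2 ?posrE ?invr_gt0//.
  by rewrite (le_trans (ltW (truncnS_gt _)))// ler_nat.
have LX n : X n \in Lfun P 2%:E by exact: RS_sum_Lfun2.
have [e e0|I LI hI] := @L2_complete _ _ _ P X LX.
  have [dl dl0 h] := RS_sum_cauchy t cg sv e0.
  have [k hk] := mesh_small _ dl0.
  by exists k => m n km kn; apply: h; (apply: tagged_partitionW; last exact: hU); exact: hk.
exists I; split => // e e0.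
have e30 : 0 < e / 3 by rewrite divr_gt0.
have [dl dl0 h] := RS_sum_cauchy t cg sv e30; exists dl => // n u xi up.
have [k hk] := mesh_small _ dl0.
have [k' hk'] := hI _ e30.
have mX m := Lfun2_measurable (LX m).
pose m := maxn k k'.
set Z := RS_sum _ _ _ _ _.
have mZ : measurable_fun setT Z by apply: Lfun2_measurable; exact: RS_sum_Lfun2.
rewrite (le_lt_trans (L2dist_triangle P mZ (mX m) (Lfun2_measurable LI)))//.
apply: (@le_lt_trans _ _ ((e / 3)%:E + (e / 3)%:E)%E).
  apply: leeD; last by apply: hk'; exact: leq_maxr.
  apply: h => //; apply: tagged_partitionW; last exact: hU.
  by apply: hk; exact: leq_maxl.
by rewrite -EFinD lte_fin; lra.
Qed.

End subordinator.
End L2_riemann_stieltjes.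

(** * Integrals over half-lines and over the line *)

Section ereal_limits.
Context {R : realType}.

Lemma cvge0P (U : Type) (F : set_system U) {FF : Filter F} (f : U -> \bar R) :
  (forall x, 0 <= f x)%E ->
  (f @ F --> 0%E) <-> (forall e : R, 0 < e -> \forall x \near F, (f x <= e%:E)%E).
Proof.
move=> f0; split.
  move=> /fine_cvgP[ff h] e e0.
  move/cvgrPdist_lt : h => /(_ e e0) h.
  apply: filterS2 ff h => x fx; rewrite sub0r normrN ger0_norm ?fine_ge0// => /ltW.
  by rewrite -lee_fin fineK.
move=> h; apply/fine_cvgP; split.
  apply: filterS (h 1 ltr01) => x fx.
  by rewrite ge0_fin_numE// (le_lt_trans fx)// ltry.
apply/cvgrPdist_le => e e0; apply: filterS (h e e0) => x fx.
have ffx : f x \is a fin_num by rewrite ge0_fin_numE// (le_lt_trans fx)// ltry.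
by rewrite sub0r normrN ger0_norm ?fine_ge0// -lee_fin fineK.
Qed.

End ereal_limits.

Section improper_integrals.
Context {d : measure_display} {T : measurableType d} {R : realType}.
Variable P : probability T R.
Variable S : R -> {RV P >-> R}.
Variable om : R -> R.
Hypotheses (hS : second_order_subordinator S) (hom : increment_modulus S om).
Implicit Types (f g : R -> R) (s t v : R) (I : T -> R).

Lemma ninfty_addZ f g c t I J :
  is_RS_integral_ninfty S f t I -> is_RS_integral_ninfty S g t J ->
  is_RS_integral_ninfty S (fun u => f u + c * g u) t (fun w => I w + c * J w).
Proof.
move=> [LI [G hG cG]] [LJ [H hH cH]]; split; first exact: Lfun2D.
exists (fun s w => G s w + c * H s w).
  by move=> s st; apply: RS_integral_addZ => //; [exact: hG|exact: hH].
have mI := Lfun2_measurable LI; have mJ := Lfun2_measurable LJ.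
apply/cvge0P => [s|e e0]; first exact: L2dist_ge0.
have e20 : 0 < e / 2 by rewrite divr_gt0.
have c0 : 0 < `|c| + 1 by rewrite ltr_wpDl.
have {}cG := (cvge0P (fun s => L2dist_ge0 P (G s) I)).1 cG _ e20.
have {}cH := (cvge0P (fun s => L2dist_ge0 P (H s) J)).1 cH _ (divr_gt0 e20 c0).
near=> s.
have st : s < t by near: s; apply: nbhs_ninfty_lt; exact: num_real.
have mG := Lfun2_measurable (is_RS_integral_Lfun (hG s st)).
have mH := Lfun2_measurable (is_RS_integral_Lfun (hH s st)).
have mGI : measurable_fun setT (G s \- I) by exact: measurable_funB.
have mHJ : measurable_fun setT (H s \- J) by exact: measurable_funB.
have mcHJ : measurable_fun setT (fun w => c * (H s \- J) w) by exact: measurable_funM.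
rewrite L2distE (_ : _ \- _ = (G s \- I) \+ (fun w => c * (H s \- J) w)); last first.
  by apply/funext => w /=; ring.
rewrite (le_trans (L2norm_triangle P mGI mcHJ))// L2normZ//.
have h1 : (L2norm P (G s \- I)%R <= (e / 2)%:E)%E by near: s; exact: cG.
have h2 : (L2norm P (H s \- J)%R <= (e / 2 / (`|c| + 1))%:E)%E by near: s; exact: cH.
apply: (@le_trans _ _ ((e / 2)%:E + `|c|%:E * (e / 2 / (`|c| + 1))%:E)%E).
  by apply: leeD => //; rewrite lee_wpmul2l ?lee_fin.
rewrite -EFinM -EFinD lee_fin.
have : `|c| * (e / 2 / (`|c| + 1)) <= e / 2.
  by rewrite mulrCA ler_piMr ?(ltW e20)// ler_pdivrMr// mul1r lerDl.
lra.
Unshelve. all: by end_near. Qed.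

Lemma ninfty_0 t : is_RS_integral_ninfty S (fun=> 0) t (fun=> 0).
Proof.
have z s v : is_RS_integral S (fun=> 0) s v (fun=> 0).
  split=> [|e e0]; first exact: Lfun2_0.
  exists 1 => // n u xi _; rewrite L2distE (_ : _ \- _ = fun=> 0) ?L2norm0//.
  by apply/funext => w; rewrite /= /RS_sum big1 ?subr0// => i _; rewrite mul0r.
split; first exact: Lfun2_0.
exists (fun _ => fun=> 0) => // .
rewrite (_ : (fun _ => _) = fun=> 0%E); first exact: cvg_cst.
apply/funext => s; rewrite L2distE (_ : _ \- _ = fun=> 0) ?L2norm0//.
by apply/funext => w /=; rewrite subr0.
Qed.

Lemma ninfty_sum (A : Type) (r : seq A) (c : A -> R) (f : A -> R -> R) (I : A -> T -> R) t :
  (forall i, is_RS_integral_ninfty S (f i) t (I i)) ->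
  is_RS_integral_ninfty S (fun u => \sum_(i <- r) c i * f i u) t
    (fun w => \sum_(i <- r) c i * I i w).
Proof.
move=> h; elim: r => [|i r ih].
  under [X in is_RS_integral_ninfty _ X]eq_fun do rewrite big_nil.
  under [X in is_RS_integral_ninfty _ _ _ X]eq_fun do rewrite big_nil.
  exact: ninfty_0.
under [X in is_RS_integral_ninfty _ X]eq_fun do rewrite big_cons addrC.
under [X in is_RS_integral_ninfty _ _ _ X]eq_fun do rewrite big_cons addrC.
exact: ninfty_addZ.
Qed.

(** A block of length at most 1 that ends at s contributes at most
    K om(1) e^(- nu (t - s)) in L^2. The blocks going back from s form a
    geometric series of ratio q = e^(- nu); its sum is D = K om(1) / (1 - q),
    the solution of D q + K om(1) = D. *)
Lemma RS_integral_tail g t K nu : continuous g -> 0 <= K -> 0 < nu ->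
  (forall u, u <= t -> `|g u| <= K * expR (- nu * (t - u))) ->
  exists2 D, 0 <= D & forall s' s I, s' < s -> s <= t ->
    is_RS_integral S (truncate g t) s' s I ->
    (L2norm P I <= (D * expR (- nu * (t - s)))%:E)%E.
Proof.
move=> cg K0 nu0 hg.
pose q := expR (- nu); have q1 : q < 1 by rewrite expR_lt1 oppr_lt0.
have q1' : 0 < 1 - q by rewrite subr_gt0.
have om1 : 0 <= om 1 := im_ge0 hom 1.
pose D := K * om 1 / (1 - q); have D0 : 0 <= D by rewrite divr_ge0 ?mulr_ge0// ltW.
have DE : D * q + K * om 1 = D by rewrite /D; field; rewrite gt_eqF.
have short s' s I : s' < s -> s <= t -> s - s' <= 1 ->
    is_RS_integral S (truncate g t) s' s I ->
    (L2norm P I <= (K * om 1 * expR (- nu * (t - s)))%:E)%E.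
  move=> ss st s1 hI.
  have c0 : 0 <= K * expR (- nu * (t - s)) by rewrite mulr_ge0// expR_ge0.
  rewrite (le_trans (RS_integral_norm hS hom ss c0 _ hI))//.
    move=> u /andP[_ us]; rewrite truncate_id ?(le_trans us)//.
    rewrite (le_trans (hg _ (le_trans us st)))// ler_wpM2l// ler_expR.
    by rewrite !mulNr lerN2 ler_wpM2l ?(ltW nu0)// lerB.
  rewrite lee_fin [leRHS]mulrAC ler_wpM2l// (im_homo hom)// subr_ge0; exact: ltW.
exists D => //.
have main n : forall s' s I, s' < s -> s <= t -> s - s' <= n.+1%:R ->
    is_RS_integral S (truncate g t) s' s I ->
    (L2norm P I <= (D * expR (- nu * (t - s)))%:E)%E.
  elim: n => [|n ih] s' s I ss st sn hI.
    rewrite (le_trans (short _ _ _ ss st sn hI))// lee_fin ler_wpM2r ?expR_ge0//.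
    by rewrite -DE lerDr mulr_ge0// expR_ge0.
  have [s1|s1] := leP (s - s') 1.
    rewrite (le_trans (short _ _ _ ss st s1 hI))// lee_fin ler_wpM2r ?expR_ge0//.
    by rewrite -DE lerDr mulr_ge0// expR_ge0.
  have ss1 : s' < s - 1 by lra.
  have s1s : s - 1 < s by lra.
  have [I1 hI1] := RS_integral_exists hS hom t cg ss1.
  have [I2 hI2] := RS_integral_exists hS hom t cg s1s.
  have mI := Lfun2_measurable (is_RS_integral_Lfun hI).
  have mI1 := Lfun2_measurable (is_RS_integral_Lfun hI1).
  have mI2 := Lfun2_measurable (is_RS_integral_Lfun hI2).
  rewrite (L2norm_eq_ae mI (measurable_funD mI1 mI2) (RS_integral_split hS ss1 s1s hI hI1 hI2)).
  rewrite (le_trans (L2norm_triangle P mI1 mI2))//.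
  have st1 : s - 1 <= t by lra.
  have sn1 : s - 1 - s' <= n.+1%:R by move: sn; rewrite -[n.+2%:R]natr1; lra.
  have s11 : s - (s - 1) <= 1 by lra.
  rewrite (le_trans (leeD (ih _ _ _ ss1 st1 sn1 hI1) (short _ _ _ s1s st s11 hI2)))//.
  rewrite -EFinD lee_fin.
  have -> : - nu * (t - (s - 1)) = - nu + - nu * (t - s) by ring.
  by rewrite expRD mulrA -mulrDl -/q DE.
move=> s' s I ss st hI; apply: (main (Num.truncn (s - s')) _ _ _ ss st _ hI).
exact/ltW/truncnS_gt.
Qed.

(** The integral over [s', s] is the difference of those over [s', t] and
    [s, t], so [RS_integral_tail] is a Cauchy estimate as s tends to -oo. *)
Lemma ninfty_exists g t K nu : continuous g -> 0 <= K -> 0 < nu ->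
  (forall u, u <= t -> `|g u| <= K * expR (- nu * (t - u))) ->
  exists I, is_RS_integral_ninfty S g t I.
Proof.
move=> cg K0 nu0 hg.
have [D D0 hD] := RS_integral_tail cg K0 nu0 hg.
have /choice[G hG] s : exists I, s < t -> is_RS_integral S (truncate g t) s t I.
  have [st|] := ltP s t; last by exists (fun=> 0).
  by have [I hI] := RS_integral_exists hS hom t cg st; exists I.
have dG s' s : s' < s -> s < t ->
    (L2_dist P (G s') (G s) <= (D * expR (- nu * (t - s)))%:E)%E.
  move=> ss st; have s't := lt_trans ss st.
  have [I hI] := RS_integral_exists hS hom t cg ss.
  have mI := Lfun2_measurable (is_RS_integral_Lfun hI).
  have m' := Lfun2_measurable (is_RS_integral_Lfun (hG _ s't)).
  have m := Lfun2_measurable (is_RS_integral_Lfun (hG _ st)).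
  apply: le_trans (hD _ _ _ ss (ltW st) hI).
  rewrite L2distE (@L2norm_eq_ae _ _ _ P _ I)//; first exact: measurable_funB.
  apply: filterS (RS_integral_split hS ss st (hG _ s't) hI (hG _ st)) => w /= ->.
  by rewrite addrK.
have small (e : R) : 0 < e -> exists s0, s0 < t /\ forall s, s <= s0 -> D * expR (- nu * (t - s)) <= e.
  move=> e0; have D1 : 0 < D + 1 by rewrite ltr_wpDl.
  pose x := e / (D + 1); have x0 : 0 < x by rewrite divr_gt0.
  exists (Num.min (t - 1) (t + ln x / nu)); split; first by rewrite gt_min; apply/orP; left; lra.
  move=> s; rewrite le_min => /andP[_ h].
  have : expR (- nu * (t - s)) <= x.
    rewrite -[leRHS]lnK ?posrE// ler_expR.
    have : nu * (s - t) <= nu * (ln x / nu) by rewrite ler_wpM2l ?(ltW nu0)//; lra.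
    have -> : nu * (ln x / nu) = ln x by field; rewrite gt_eqF.
    lra.
  move=> /(ler_wpM2l D0) /le_trans; apply.
  by rewrite /x mulrCA ler_piMr ?(ltW e0)// ler_pdivrMr// mul1r lerDl.
pose tn (n : nat) := t - n.+1%:R.
have tnt n : tn n < t by rewrite /tn ltrBlDr ltrDl.
have tn_small s0 : exists N, forall n, (N <= n)%N -> tn n < s0.
  exists (Num.truncn `|t - s0|) => n Nn.
  have : `|t - s0| < n.+1%:R by rewrite (lt_le_trans (truncnS_gt _))// ler_nat.
  by have := ler_norm (t - s0); rewrite /tn; lra.
have LG n : G (tn n) \in Lfun P 2%:E by apply: is_RS_integral_Lfun (hG _ (tnt n)).
have mG n := Lfun2_measurable (LG n).
have dS e s0 (h : forall s, s <= s0 -> D * expR (- nu * (t - s)) <= e) s s' :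
    0 < e -> s < t -> s' < t -> s <= s0 -> s' <= s0 -> (L2_dist P (G s) (G s') <= e%:E)%E.
  move=> e0 st s't ss ss'; have [a|a|->] := ltgtP s s'.
  - by rewrite (le_trans (dG _ _ a s't))// lee_fin h.
  - by rewrite L2dist_sym (le_trans (dG _ _ a st))// lee_fin h.
  - rewrite L2distE (_ : _ \- _ = fun=> 0) ?L2norm0 ?lee_fin ?ltW//.
    by apply/funext => w /=; rewrite subrr.
have [e e0|I LI hI] := L2_complete LG.
  have [s0 [s0t hs0]] := small _ e0; have [N hN] := tn_small s0.
  by exists N => m n Nm Nn; apply: (dS _ _ hs0) => //; apply: ltW; exact: hN.
exists I; split => //; exists G.
  move=> s st; apply: eq_RS_integral (hG _ st) => u /andP[_ ut].
  exact: truncate_id.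
apply/cvge0P => [s|e e0]; first exact: L2dist_ge0.
have e20 : 0 < e / 2 by rewrite divr_gt0.
have [s0 [s0t hs0]] := small _ e20; have [N hN] := tn_small s0.
have [N' hN'] := hI _ e20.
near=> s.
have ss0 : s < s0 by near: s; apply: nbhs_ninfty_lt; exact: num_real.
have st := lt_trans ss0 s0t.
pose n := maxn N N'.
have m := Lfun2_measurable (is_RS_integral_Lfun (hG _ st)).
rewrite (le_trans (L2dist_triangle P m (mG n) (Lfun2_measurable LI)))//.
apply: (@le_trans _ _ ((e / 2)%:E + (e / 2)%:E)%E).
  apply: leeD; last by apply: hN'; exact: leq_maxr.
  apply: (dS _ _ hs0 _ _ e20 st (tnt n) (ltW ss0)).
  by apply/ltW/hN; exact: leq_maxl.
by rewrite -EFinD lee_fin -splitr.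
Unshelve. all: by end_near. Qed.

(** For v > t the integral of the cut-off kernel over [s, v] is that over
    [s, t], because the part over [t, v] vanishes. *)
Lemma line_of_ninfty g t Y : continuous g ->
  is_RS_integral_ninfty S g t Y -> is_RS_integral_line S (truncate g t) Y.
Proof.
move=> cg [LY [H hH cH]]; split => //.
have /choice[G hG] (sv : R * R) : exists I, sv.1 < sv.2 ->
    is_RS_integral S (truncate g t) sv.1 sv.2 I.
  have [lt|] := ltP sv.1 sv.2; last by exists (fun=> 0).
  by have [I hI] := RS_integral_exists hS hom t cg lt; exists I.
exists (fun s v => G (s, v)); first by move=> s v; exact: (hG (s, v)).
have mY := Lfun2_measurable LY.
apply/cvge0P => [sv|e e0]; first exact: L2dist_ge0.
have {}cH := (cvge0P (fun s => L2dist_ge0 P (H s) Y)).1 cH _ e0.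
have hnear : \forall s \near -oo, s < t /\ (L2_dist P (H s) Y <= e%:E)%E.
  near=> s; split; last by near: s; exact: cH.
  by near: s; apply: nbhs_ninfty_lt; exact: num_real.
exists ([set s | s < t /\ (L2_dist P (H s) Y <= e%:E)%E], [set v | t < v]) => /=.
  split; last by apply: nbhs_pinfty_gt; exact: num_real.
  exact: hnear.
move=> [s v] /= [[st Hs] tv]; have sv := lt_trans st tv.
have hG1 := hG (s, v) sv.
have [I2 hI2] := RS_integral_exists hS hom t cg tv.
have hI1 : is_RS_integral S (truncate g t) s t (H s).
  apply: eq_RS_integral (hH _ st) => u /andP[_ ut]; by rewrite truncate_id.
have I20 : {ae P, forall w, I2 w = 0}.
  apply: (RS_integral_eq0 tv) hI2 => u /andP[tu _].
  exact: truncate_eq0.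
have mG := Lfun2_measurable (is_RS_integral_Lfun hG1).
have mH := Lfun2_measurable (is_RS_integral_Lfun hI1).
apply: le_trans Hs; rewrite !L2distE.
apply: L2norm_le_ae; [exact: measurable_funB|exact: measurable_funB|].
apply: filterS2 I20 (RS_integral_split hS st tv hG1 hI1 hI2) => w /= -> ->.
by rewrite addr0.
Unshelve. all: by end_near. Qed.

(** The limit superior of the Z_n is measurable for the sub-sigma-algebra and
    agrees with Y off a null set, so the preimages differ by a negligible set. *)
Lemma completed_sigmaP (G : set (set T)) (Y : T -> R)
    (Z : nat -> T -> R) :
  (forall n, measurable_fun setT (Z n : g_sigma_algebraType G -> R)) ->
  {ae P, forall w, Z n w @[n --> \oo] --> Y w} ->
  forall B : set R, measurable B -> completed_sigma P <<s G>> (Y @^-1` B).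
Proof.
move=> mZ aeZ B mB.
pose Z' (w : g_sigma_algebraType G) := fine (limn_esup (fun n => (Z n w)%:E)).
have mZ' : measurable_fun setT Z'.
  apply: measurableT_comp => //; apply: measurable_fun_limn_esup => n.
  exact/measurable_EFinP.
have ZY : {ae P, forall w, Z' w = Y w}.
  apply: filterS aeZ => w h.
  have Xl' : (Z n w)%:E @[n --> \oo] --> (Y w)%:E by apply: cvg_EFin => //; exact: nearW.
  rewrite /Z' is_cvg_limn_esupE; last by apply/cvg_ex; exists (Y w)%:E.
  by rewrite (cvg_lim _ Xl').
pose N := [set w | Z' w <> Y w].
have nN : P.-negligible N by exact: ZY.
have sN A : A `<=` N -> completed_sigma P <<s G>> A.
  by move=> AN; apply: sub_sigma_algebra; right; exact: negligibleS nN.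
have sZ : completed_sigma P <<s G>> (Z' @^-1` B).
  apply: sub_sigma_algebra; left.
  by have := mZ' measurableT B mB; rewrite setTI.
have -> : Y @^-1` B = ((Z' @^-1` B) `\` N) `|` (Y @^-1` B `&` N).
  apply/seteqP; split=> w /=.
    move=> YB; have [Nw|nNw] := pselect (N w); [by right|left].
    by split => //; move/contrapT: nNw => ->.
  by move=> [[ZB /contrapT <-]//|[]].
pose C := <<s G>> `|` [set N | P.-negligible N].
apply: (@measurableU _ (g_sigma_algebraType C)).
  by apply: (@measurableD _ (g_sigma_algebraType C)) => //; exact: sN.
by apply: sN => w [].
Qed.

Lemma causal_of_ninfty g t Y : is_RS_integral_ninfty S g t Y ->
  forall B : set R, measurable B ->
    completed_sigma P (sigma_increments S [set uv | uv.1 <= uv.2 /\ uv.2 <= t]) (Y @^-1` B).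
Proof.
move=> [LY [G hG cG]].
have mY := Lfun2_measurable LY.
have approx n : exists n' u xi s m, tagged_partition s t m n' u xi /\
    (L2_dist P (RS_sum S g n' u xi) Y <= (4^-1 ^+ n)%:E)%E.
  have q0 : 0 < 4^-1 ^+ n / 2 :> R by rewrite divr_gt0// exprn_gt0// invr_gt0.
  have {}cG := (cvge0P (fun s => L2dist_ge0 P (G s) Y)).1 cG _ q0.
  have hnear : \forall s \near -oo, s < t /\ (L2_dist P (G s) Y <= (4^-1 ^+ n / 2)%:E)%E.
    near=> s; split; last by near: s; exact: cG.
    by near: s; apply: nbhs_ninfty_lt; exact: num_real.
  have [s [st Gs]] := filter_ex hnear.
  have [dl dl0 h] := RS_integral_right st (hG _ st) q0.
  have [n' [u [up hn']]] := h dl dl0 (lexx _).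
  exists n', u, (fun i => u i.+1), s, dl; split => //.
  have mR : measurable_fun setT (RS_sum S g n' u (fun i => u i.+1)).
    by apply: Lfun2_measurable; exact: RS_sum_Lfun2.
  have mG := Lfun2_measurable (is_RS_integral_Lfun (hG _ st)).
  rewrite (le_trans (L2dist_triangle P mR mG mY))//.
  by rewrite (le_trans (leeD (ltW hn') Gs))// -EFinD lee_fin -splitr.
have /choice[Z hZ] n : exists Z, (L2_dist P Z Y <= (4^-1 ^+ n)%:E)%E /\
    exists n' u xi s m, tagged_partition s t m n' u xi /\ Z = RS_sum S g n' u xi.
  have [n' [u [xi [s [m [up h]]]]]] := approx n.
  by exists (RS_sum S g n' u xi); split => //; exists n', u, xi, s, m.
have mZ n : measurable_fun setT (Z n).
  have [_ [n' [u [xi [s [m [_ ->]]]]]]] := hZ n.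
  by apply: Lfun2_measurable; exact: RS_sum_Lfun2.
apply: (completed_sigmaP (Z := Z)); last first.
  by apply: fast_L2_cvg_ae => // n; have [] := hZ n.
move=> n; have [_ [n' [u [xi [s [m [up ->]]]]]]] := hZ n.
apply: measurable_sum => i; apply: measurable_funM => //.
move=> _ B mB; rewrite setTI; apply: sub_sigma_algebra.
exists (u i, u i.+1); last by exists B => //; rewrite setTI.
by split; [exact: (partition_step up)|exact: (partition_le up)].
Unshelve. all: by end_near. Qed.

End improper_integrals.

(** * The CARMA process *)

Section carma.
Context {R : realType} {d : measure_display} {T : measurableType d}.
Variable P : probability T R.

Lemma carma_kernel_truncate p (a b : nat -> R) t :
  (fun u => carma_kernel p a b (t - u)) =
  truncate (fun u => \sum_(i < p) b i *
    (expmx ((t - u) *: carma_mx p a) *m carma_e p) i ord0) t.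
Proof.
apply/funext => u; rewrite /carma_kernel /truncate indicE; congr (_ * _%:R).
  rewrite -mulmxA mxE; apply: eq_bigr => i _.
  by rewrite [_^T _ _]mxE [carma_b _ _ _ _]mxE.
by congr nat_of_bool; apply/idP/idP; rewrite inE /= in_itv/= andbT subr_ge0.
Qed.

Lemma carma_state_kernelP p (a : nat -> R) (i : 'I_p) t :
  spectrum_negative (carma_mx p a) ->
  let g u := (expmx ((t - u) *: carma_mx p a) *m carma_e p) i ord0 in
  continuous g /\ exists K nu : R, [/\ 0 <= K, 0 < nu &
    forall u, u <= t -> `|g u| <= K * expR (- nu * (t - u))].
Proof.
move=> hA g; have [cf [K [nu [K0 nu0 h]]]] := state_kernelP i hA.
split.
  move=> u; apply: (@continuous_comp _ _ _ (fun u => t - u)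
    (fun x => (expmx (x *: carma_mx p a) *m carma_e p) i ord0)); last exact: cf.
  by apply: cvgB; [exact: cvg_cst|exact: cvg_id].
by exists K, nu; split => // u ut; apply: h; rewrite subr_ge0.
Qed.

Lemma carma_process_ninfty p (a b : nat -> R) (S : R -> {RV P >-> R})
    (X : R -> T -> 'cV[R]_p) t :
  second_order_subordinator S -> is_carma_state a S X ->
  is_RS_integral_ninfty S (fun u => \sum_(i < p) b i *
    (expmx ((t - u) *: carma_mx p a) *m carma_e p) i ord0) t (carma_process b X t).
Proof.
move=> hS hX.
have -> : carma_process b X t = (fun w => \sum_(i < p) b i * X t w i ord0).
  apply/funext => w; rewrite /carma_process mxE; apply: eq_bigr => i _.
  by rewrite [_^T _ _]mxE [carma_b _ _ _ _]mxE.
exact: (ninfty_sum hS _ (fun i : 'I_p => b i) (hX t)).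
Qed.

End carma.

Theorem proposition4p3
  (R : realType) (d : measure_display) (T : measurableType d)
  (P : probability T R)
  (r : nat) (s lam : nat -> R) (hblocks : periodic_blocks r s lam)
  (rho : R -> R) (hrho : periodic_intensity r s lam rho)
  (M : R.-ker T ~> measurableTypeR R)
  (hM : poisson_random_measure P (mean_measure rho) M)
  (J : {RV P >-> R}) (hJ : (J : T -> R) \in Lfun P 2%:E)
  (atom mark : nat -> {RV P >-> R}) (hmarks : iid_marked_atoms M J atom mark)
  (gamma : R) (S : R -> {RV P >-> R})
  (hpath : compound_path gamma atom mark S)
  (hS : second_order_subordinator S)
  (p q : nat) (a b : nat -> R) (hab : carma_coefficients p q a b)
  (hA : spectrum_negative (carma_mx p a)) :
  (exists X : R -> T -> 'cV[R]_p, is_carma_state a S X) /\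
  (forall X : R -> T -> 'cV[R]_p, is_carma_state a S X ->
    (forall t : R,
      is_RS_integral_line S (fun u => carma_kernel p a b (t - u))
        (carma_process b X t)) /\
    (independent_of_future S X -> causal_function S (carma_process b X))).
Proof.
have [om hom] := increment_modulusP hblocks hrho hM hJ hmarks hpath.
split.
  have /choice[Z hZ] (ti : R * 'I_p) : exists I, is_RS_integral_ninfty S
      (fun u => (expmx ((ti.1 - u) *: carma_mx p a) *m carma_e p) ti.2 ord0) ti.1 I.
    have [cg [K [nu [K0 nu0 h]]]] := carma_state_kernelP ti.2 ti.1 hA.
    exact: (ninfty_exists hS hom cg K0 nu0 h).
  exists (fun t w => \col_i Z (t, i) w) => t i.
  under [X in is_RS_integral_ninfty _ _ _ X]eq_fun do rewrite mxE.
  exact: (hZ (t, i)).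
move=> X hX; have hY t := carma_process_ninfty b t hS hX.
split=> [t|_ t B mB]; last exact: (causal_of_ninfty hS (hY t) mB).
rewrite carma_kernel_truncate; apply: (line_of_ninfty hS hom _ (hY t)).
move=> u; apply: cvg_big => //; first exact: add_continuous.
move=> i _; apply: cvgMl_tmp.
by have [cg _] := carma_state_kernelP i t hA; exact: cg.
Qed.
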